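(* Let $(x_k)_{k\ge0}$ and $(y_k)_{k\ge0}$ be generated by the regularized proximal-extragradient method $$y_k=\operatorname{prox}_{s g_k}\bigl(x_k-s\Phi_k(x_k)\bigr),\qquad x_{k+1}=\operatorname{prox}_{s g_k}\bigl(x_k-s\Phi_k(y_k)\bigr)\qquad(k\ge0),$$ with $x_0\in\mathcal H$ and $s\in(0,\frac1{L_V})$, let $x^*$ be an optimal solution of the bilevel problem of minimizing $H=h+\hat h$ over $\operatorname{zer}(V+\partial\hat f)$, and let $(\xi_{\hat f,k})_{k\ge1}$ be the subgradients defined in the context. The following statements hold. (i) If $V+\partial\hat f$ satisfies the discrete Attouch--Czarnecki-type condition and $\delta>\frac12$, then $\operatorname{dist}(0,V(x_k)+\partial\hat f(x_k))\le\|V(x_k)+\xi_{\hat f,k}\|=o\left(\frac1{\sqrt k}\right)$ as $k\to+\infty$. (ii) If $V+\partial\hat f$ satisfies the discrete Attouch--Czarnecki-type condition and $\delta=\frac12$, then, as $k\to+\infty$, $$\operatorname{dist}(0,V(x_k)+\partial\hat f(x_k))\le\|V(x_k)+\xi_{\hat f,k}\|=\mathcal O\left(\frac1{\sqrt k}\right),$$ $$\langle x_k-x^*,V(x_k)\rangle+\hat f(x_k)-\hat f(x^* )=o\left(\frac1{\sqrt k}\right),\qquad H(x_k)\to H(x^* ).$$ Furthermore, $(x_k)_{k\ge0}$ converges weakly to an optimal solution of the bilevel problem. (iii) If $V+\partial\hat f$ satisfies the sharpness condition with exponent $\rho\in(1,2)$ and $\frac1{\rho^*}<\delta<\frac12$,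 where $\frac1\rho+\frac1{\rho^*}=1$, then, as $k\to+\infty$, $$\operatorname{dist}(0,V(x_k)+\partial\hat f(x_k))\le\|V(x_k)+\xi_{\hat f,k}\|=\mathcal O\left(\frac1{k^\delta}\right),$$ $$\langle x_k-x^*,V(x_k)\rangle+\hat f(x_k)-\hat f(x^* )=o\left(\frac1{\sqrt k}\right),\qquad |H(x_k)-H(x^* )|=o\left(\frac1{k^{\frac12-\delta}}\right).$$ Furthermore, $(x_k)_{k\ge0}$ converges weakly to an optimal solution of the bilevel problem.
   Context: $\mathcal H$ is a real Hilbert space. $h:\mathcal H\to\mathbb R$ is convex, continuously Fréchet differentiable, with $\nabla h$ $L_{\nabla h}$-Lipschitz continuous, $L_{\nabla h}>0$. $V:\mathcal H\to\mathcal H$ is monotone and $L_V$-Lipschitz continuous, $L_V>0$. $\hat f,\hat h:\mathcal H\to\overline{\mathbb R}$ are proper, convex, lower semicontinuous. $H:=h+\hat h$. Put $Z:=\operatorname{zer}(V+\partial\hat f)=\{x:0\in V(x)+\partial\hat f(x)\}$. The bilevel problem is to minimize $H$ over $Z$; an optimal solution is a minimizer of $H$ over $Z$. Constants $c,a,\delta>0$ are fixed and $\varepsilon_k:=\frac{c}{(k+a)^\delta}$. Standing assumptions: $\partial(\hat f+\varepsilon_k\hat h)=\partial\hat f+\varepsilon_k\partial\hat h$ for every $k\ge0$; for every optimal solution $x^*$, $0\in\partial H(x^* )+N_Z(x^* )$, where $N_Z(x^* )=\{p:\langle p,x-x^*\rangle\le0\ \forall x\in Z\}$; $\partial\hat h$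 maps bounded subsets of its domain to bounded subsets of $\mathcal H$. Notation: $\Phi_k(x):=V(x)+\varepsilon_k\nabla h(x)$, $g_k:=\hat f+\varepsilon_k\hat h$, and $\operatorname{prox}_{\varphi}(z)$ is the unique minimizer of $u\mapsto\varphi(u)+\frac12\|u-z\|^2$. By definition of the prox, $\xi_{k+1}:=\frac{x_k-x_{k+1}}{s}-\Phi_k(y_k)\in\partial g_k(x_{k+1})$ for $k\ge0$; for every $k\ge1$ one writes $\xi_k=\xi_{\hat f,k}+\varepsilon_{k-1}\xi_{\hat h,k}$ with $\xi_{\hat f,k}\in\partial\hat f(x_k)$ and $\xi_{\hat h,k}\in\partial\hat h(x_k)$. For an optimal solution $x^*$ let $F(x):=\langle x-x^*,V(x)\rangle+\hat f(x)-\hat f(x^* )$ (depending on $x^*$), $F^*$ its Fenchel conjugate, $F^*(u)=\sup_x\{\langle x,u\rangle-F(x)\}$, and $\sigma_Z(u)=\sup_{y\in Z}\langle y,u\rangle$. Discrete Attouch--Czarnecki-type condition: for every optimal solution $x^*$ and every $p^*\in N_Z(x^* )$, $\sum_{k=0}^{+\infty}\bigl[F^*(\varepsilon_kp^* )-\sigma_Z(\varepsilon_kp^* )\bigr]<+\infty$. Sharpness condition with exponent $\rho\in(1,2)$: for every optimal solution $x^*$ there exists $\tau>0$ such that $\frac\tau\rho\operatorname{dist}(x,Z)^\rho\le\langle x-x^*,V(x)\rangle+\hat f(x)-\hat f(x^* )$ for all $x\in\mathcal H$. *)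

(* Defs.v *)
From mathcomp Require Import all_boot all_order all_algebra.
From mathcomp Require Import all_classical all_reals all_analysis.
Import Order.TTheory GRing.Theory Num.Theory.
Import numFieldNormedType.Exports.

Set Implicit Arguments.
Unset Strict Implicit.
Unset Printing Implicit Defensive.

Local Open Scope classical_set_scope.
Local Open Scope ring_scope.

Section ExtendedRealFunctions.
Context {R : realType} {E : completeNormedModType R}.
Implicit Types (phi : E -> \bar R) (A : set E).

Definition proper_efun phi : Prop :=
  (forall x, phi x != -oo%E) /\ exists x, phi x \is a fin_num.

(* Only meant for functions that avoid -oo; at t = 0 and t = 1 the convention
   0 * +oo = 0 of \bar R makes the inequality trivial. *)
Definition convex_efun phi : Prop :=
  forall (x y : E) (t : R), 0 <= t <= 1 ->
    (phi (t *: x + (1 - t) *: y)%R <= t%:E * phi x + (1 - t)%:E * phi y)%E.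

Definition argmin_on A phi : set E :=
  [set x | A x /\ forall y, A y -> (phi x <= phi y)%E].

(* u = prox_phi(z): u is the unique minimizer of phi + |. - z|^2 / 2 *)
Definition is_prox phi (z u : E) : Prop :=
  argmin_on setT (fun v => phi v + (`|v - z| ^+ 2 / 2)%:E)%E = [set u].

(* u_k = o(v_k) for an extended-real sequence u, including the claim that
   u_k is eventually finite, as fine sends both infinities to 0. *)
Definition elittleo (u : nat -> \bar R) (v : nat -> R) : Prop :=
  (\forall k \near \oo, u k \is a fin_num) /\ (fine \o u) =o_\oo v.

(* dot is meant to induce the norm of E: forall x, dot x x = `|x| ^+ 2 *)
Variable dot : {dot E for @idfun R}.

Definition is_gradient (h : E -> R) (gradh : E -> E) : Prop :=
  forall x, differentiable h x /\ forall v, 'd h x v = dot (gradh x) v.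

Definition monotone_op (V : E -> E) : Prop :=
  forall x y, 0 <= dot (V x - V y) (x - y).

(* empty outside the effective domain *)
Definition subdiff phi (x : E) : set E :=
  [set u | phi x \is a fin_num /\
           forall y, (phi x + (dot u (y - x)%R)%:E <= phi y)%E].

Definition sum_op (V : E -> E) phi (x : E) : set E :=
  [set V x + u | u in subdiff phi x].

Definition zer (T : E -> set E) : set E := [set x | T x 0].

Definition normal_cone A (xs : E) : set E :=
  [set p | forall x, A x -> dot p (x - xs) <= 0].

Definition conjugate phi (u : E) : \bar R :=
  ereal_sup (range (fun x => (dot x u)%:E - phi x)%E).

Definition support_fun A (u : E) : \bar R :=
  ereal_sup [set (dot y u)%:E | y in A].

Definition weakly_cvg (x : nat -> E) (l : E) : Prop :=
  forall v, dot (x k) v @[k --> \oo] --> dot l v.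

(* F(x) = <x - xs, V x> + f x - f xs *)
Definition gap (V : E -> E) (f : E -> \bar R) (xs x : E) : \bar R :=
  ((dot (x - xs)%R (V x))%:E + f x - f xs)%E.

(* Discrete Attouch-Czarnecki-type condition. [opt] is the set of optimal
   solutions and [Z] the set of zeros of V + subdiff f. *)
Definition attouch_czarnecki (V : E -> E) (f : E -> \bar R) (Z opt : set E)
    (eps : nat -> R) : Prop :=
  forall xs p, opt xs -> normal_cone Z xs p ->
    (\sum_(0 <= k <oo) (conjugate (gap V f xs) (eps k *: p)%R
                        - support_fun Z (eps k *: p)%R) < +oo)%E.

Definition sharpness (V : E -> E) (f : E -> \bar R) (Z opt : set E)
    (rho : R) : Prop :=
  forall xs, opt xs -> exists2 tau : R, 0 < tau &
    forall x, ((tau / rho)%:E * edist_inf Z x `^ rho <= gap V f xs x)%E.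

End ExtendedRealFunctions.

(* Main.v *)
Require Import Defs.
From mathcomp Require Import all_boot all_order all_algebra.
From mathcomp Require Import all_classical all_reals all_analysis.
From mathcomp Require Import ring lra.
Import Order.TTheory GRing.Theory Num.Theory.
Import numFieldNormedType.Exports.

(** Fix an optimal solution z, write F_z(u) = <u - z, V u> + f u - f z for the
    gap and Hmin for the optimal value.  Each of the two growth hypotheses
    (summability of the conjugates, or sharpness together with
    delta > 1 / rho') enters only through the following consequence: for every
    p in N_Z(z) there is a nonincreasing summable b >= 0 with
    eps_k <p, u - z> <= F_z(u) + b_k for all u in dom f.  It is the predicate
    [dual_gap_bound], obtained in [attouch_czarnecki_dual_gap] with
    b_k = F_z^*(eps_k p) - sigma_Z(eps_k p), and in [sharpness_dual_gap] from
    Young's inequality with b_k of order eps_k^rho'.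

    Energy.  By the optimality condition some -p with p in N_Z(z) is a
    subgradient of H at z, so F_z + eps_k (H - Hmin) >= F_z / 2 - b_k
    ([gap_half]).  In the energy inequality of the extragradient step
    ([energy_step]) this makes |x_k - z|^2 nonincreasing up to a summable error:
    it converges, and |x_k - y_k|^2 and |y_k - x_{k+1}|^2 are summable
    ([fejer]).

    Residual.  Let w_k = Phi_k(x_{k+1}) + xi_{k+1}; its squared norm is summable
    because the steps are.  For a fixed operator an extragradient step does not
    increase the residual: this follows from the monotonicity of Phi_k and the
    cyclic monotonicity of the subdifferential along x, y, x_+
    ([tangent_cyclic], [tangent_residual_step]).  Passing from eps_k to eps_{k+1}
    moves the residual by (eps_k - eps_{k+1}) v_k with v_k in dH(x_{k+1}).
    Bounding this drift by its norm is too coarse when delta < 1 / 2.  The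
    inner product of v_k with the step x_{k+2} - x_{k+1} is however at most
    H(x_{k+2}) - H(x_{k+1}), so to first order the drift is a difference
    ([residual_drift]), and summation by parts against the slowly varying
    weights k (eps_k - eps_{k+1}) yields k |w_k|^2 -> 0 for every delta > 0
    ([weighted_rate], [residual_rate]).

    Rates.  All the rates follow.  First, V(x_{k+1}) + xi_{f,k+1} = w_k - eps_k v_k
    with v_k bounded, so its norm is o(1 / sqrt k) + O(k^-delta).  Secondly,
    F_z(x_{k+1}) + eps_k (H(x_{k+1}) - Hmin) <= <w_k, x_{k+1} - z> = o(1 / sqrt k),
    whereas the lower bound from the energy part is F_z / 2 - b_k with
    b_k = o(1 / k), a nonincreasing summable sequence; hence both F_z and
    eps_k |H - Hmin| are o(1 / sqrt k) along the iterates ([gap_value_rates]).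

    Weak convergence.  When H(x_k) -> Hmin, every weak limit l of the iterates is
    optimal: it is a zero of V + df by Minty's argument ([weak_limit_zero]), and
    H(l) <= Hmin because convex lower semicontinuous functions are weakly lower
    semicontinuous ([weak_lsc]).  Opial's argument ([opial]) concludes.  Weak limits
    are taken along ultrafilters on the indices, where bounded scalar sequences
    always converge; the limit functional is then represented by a vector, as in
    the Riesz theorem.  That representation and the projection onto a closed
    convex set are the two instances of [stampacchia] used here. *)

Set Implicit Arguments.
Unset Strict Implicit.
Unset Printing Implicit Defensive.

Local Open Scope classical_set_scope.
Local Open Scope ring_scope.

(** * Summable real sequences *)

Section RealSequences.
Context {R : realType}.
Implicit Types (a b d e q u A G : R^nat) (B C m : R).

Lemma nnseries_bounded_cvgn u M : (forall k, 0 <= u k) ->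
  (forall n, series u n <= M) -> cvgn (series u).
Proof.
move=> u0 uM; apply: nondecreasing_is_cvgn.
  by apply/nondecreasing_seqP => n; rewrite seriesSr lerDl.
by exists M => _ [n _ <-].
Qed.

Lemma cvgn_bounded u : cvgn u -> exists M, forall k, `|u k| <= M.
Proof.
move=> /cvg_seq_bounded [M [_ Mb]].
by exists (M + 1) => k; apply: Mb => //; rewrite ltrDl.
Qed.

Lemma nnseries_shift_cvgn u : (forall k, 0 <= u k) -> cvgn (series u) ->
  cvgn (series (fun k => u k.+1)).
Proof.
move=> u0 /cvgn_bounded [M uM]; apply: (@nnseries_bounded_cvgn _ M) => // n.
apply: le_trans (le_trans (ler_norm _) (uM n.+1)).
by rewrite seriesEnat /= [leRHS]big_nat_recl //= lerDr.
Qed.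

(** The difference of a and the partial sums of e is eventually nonincreasing,
    and the sums of q are what it loses. *)
Lemma quasi_fejer a q e (K : nat) :
    (forall k, 0 <= a k) -> (forall k, 0 <= q k) -> cvgn (series e) ->
    (forall k, (K <= k)%N -> a k.+1 + q k <= a k + e k) ->
  cvgn a /\ cvgn (series q).
Proof.
move=> a0 q0 ecvg step.
have [M Mle] := cvgn_bounded ecvg.
have acvg : cvgn a.
  have -> : a = (a - series e) + series e by apply/funext => n /=; rewrite !fctE; ring.
  apply: is_cvgD => //; apply: (@near_nonincreasing_is_cvgn _ _ (- M)).
    exists K => // n /= Kn m nm.
    rewrite -(subnK nm); elim: (m - n)%N => [|j IH]; first by rewrite add0n.
    apply: le_trans IH; rewrite addSn !fctE seriesSr.
    have := step _ (leq_trans Kn (leq_addl j n)); have := q0 (j + n)%N; lra.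
  by near=> n; have := Mle n; rewrite ler_norml !fctE; have := a0 n; lra.
split => //.
rewrite -(is_cvg_series_restrict K).
apply: (@near_nondecreasing_is_cvgn _ _ (a K + 2 * M)).
  exists K => // n /= Kn m nm.
  rewrite (big_cat_nat _ nm) //= lerDl; exact: sumr_ge0.
exists K => // n /= Kn.
have : \sum_(K <= k < n) q k + a n <= a K + (series e n - series e K).
  rewrite -(subnK Kn); elim: (n - K)%N => [|j IH]; first by rewrite add0n big_geq //; lra.
  have := step _ (leq_addl j K).
  rewrite addSn big_nat_recr ?leq_addl //= seriesSr; lra.
by have := Mle n; have := Mle K; rewrite !ler_norml; have := a0 n; lra.
Unshelve. all: by end_near. Qed.

(** A positive limit would make u_k eventually larger than a multiple of the
    harmonic sequence. *)
Lemma summable_harmonic_cvg0 u l : (forall k, 0 <= u k) -> cvgn (series u) ->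
  k%:R * u k @[k --> \oo] --> l -> l = 0.
Proof.
move=> u0 ucvg ul.
have l0 : 0 <= l.
  by apply: (cvgr_to_ge ul); near=> k; exact: mulr_ge0.
apply/eqP; rewrite eq_le l0 andbT leNgt; apply/negP => l_gt0.
have [N _ Nle] : \forall k \near \oo, l / 2 <= k%:R * u k.
  by apply: (cvgr_ge _ ul); lra.
apply: (@dvg_harmonic R).
rewrite -(is_cvg_series_restrict N.+1).
have [M uM] := cvgn_bounded ucvg.
apply: (@near_nondecreasing_is_cvgn _ _ ((2 / l) * M)).
  exists N.+1 => // n /= Kn m nm.
  by rewrite (big_cat_nat _ nm) //= lerDl; apply: sumr_ge0 => i _; exact: harmonic_ge0.
exists N.+1 => // n /= Nn.
have harm k : (N.+1 <= k)%N -> harmonic k <= (2 / l) * u k.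
  move=> Nk; have k0 : (0 : R) < k%:R by rewrite ltr0n (leq_trans _ Nk).
  have := Nle k (ltnW Nk) => /= H.
  apply: (@le_trans _ _ k%:R^-1); first by rewrite lef_pV2 ?posrE // ler_nat.
  rewrite -[leLHS]mulr1 ler_pdivrMl // mulrA [_ * (2 / l)]mulrC -mulrA.
  by rewrite -ler_pdivrMl ?divr_gt0 // invf_div mulr1.
apply: (@le_trans _ _ (\sum_(N.+1 <= k < n) (2 / l) * u k)).
  by apply: ler_sum_nat => k /andP[Nk _]; exact: harm.
rewrite -mulr_sumr ler_wpM2l ?divr_ge0 //.
apply: le_trans (le_trans (ler_norm _) (uM n)); rewrite seriesEnat /= [leRHS](big_cat_nat _ Nn) //= lerDr.
exact: sumr_ge0.
Unshelve. all: by end_near. Qed.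

(** Monotonicity gives (k + 1) u_{k+1} <= k u_k + u_{k+1}, so k u_k is
    quasi-Fejer and converges; its limit can only be 0. *)
Lemma noninc_summable_little u : (forall k, 0 <= u k) ->
  (forall k, u k.+1 <= u k) -> cvgn (series u) ->
  k%:R * u k @[k --> \oo] --> (0 : R).
Proof.
move=> u0 udec ucvg.
have u1cvg := nnseries_shift_cvgn u0 ucvg.
have [kucvg _] : cvgn (fun k => k%:R * u k) /\ cvgn (series (fun=> 0 : R)).
  apply: (@quasi_fejer _ _ (fun k => u k.+1) 0) => // [k|k _].
    exact: mulr_ge0.
  by rewrite addr0 -natr1 mulrDl mul1r lerD2r ler_wpM2l.
by have l0 := summable_harmonic_cvg0 u0 ucvg kucvg; rewrite -l0.
Qed.

(** Summation by parts: k A_k + m k d_k G_k is quasi-Fejer, because k d_k increases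
    by at most d_k at each index, d being nonincreasing, and because k d_k is bounded,
    which makes k d_k^2 summable.  As k d_k -> 0, the correction term vanishes in the
    limit. *)
Lemma weighted_rate A G d m B C (K : nat) :
    (forall k, 0 <= A k) -> cvgn (series A) ->
    (forall k, 0 <= d k) -> (forall k, d k.+1 <= d k) -> cvgn (series d) ->
    (forall k, 0 <= G k <= B) -> 0 <= m -> 0 <= C ->
    (forall k, (K <= k)%N ->
       A k.+1 <= A k + m * d k * (G k - G k.+1) + C * d k ^+ 2) ->
  k%:R * A k @[k --> \oo] --> (0 : R).
Proof.
move=> A0 Acvg d0 ddec dcvg GB m0 C0 step.
have kd0 := noninc_summable_little d0 ddec dcvg.
have B0 : 0 <= B by have /andP[] := GB 0; exact: le_trans.
have [M kdM] : exists M, forall k, k%:R * d k <= M.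
  have [M Mb] : exists M, forall k, `|k%:R * d k| <= M.
    by apply: cvgn_bounded; apply: cvgP kd0.
  by exists M => k; apply: le_trans (ler_norm _) (Mb k).
have A1cvg := nnseries_shift_cvgn A0 Acvg.
pose a k := k%:R * A k + m * (k%:R * d k) * G k.
have [acvg _] : cvgn a /\ cvgn (series (fun=> 0 : R)).
  apply: (@quasi_fejer _ _ ((fun k => A k.+1) + (m * B + C * M) *: d) K) => //.
  - by move=> k; have /andP[? ?] := GB k; rewrite addr_ge0 ?mulr_ge0.
  - rewrite seriesD; apply: is_cvgD => //; exact: is_cvg_seriesZ.
  move=> k Kk; rewrite addr0 /a !fctE /=.
  have k0 : (0 : R) <= k%:R by [].
  have /andP[G0 GB1] := GB k.+1.
  have h1 := ler_wpM2l k0 (step k Kk).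
  have h2 : m * (k.+1%:R * d k.+1) * G k.+1 <= m * ((k%:R + 1) * d k) * G k.+1.
    by rewrite ler_wpM2r // ler_wpM2l // natr1 ler_wpM2l.
  have h3 : m * d k * G k.+1 <= m * d k * B by rewrite ler_wpM2l // mulr_ge0.
  have h4 : C * d k * (k%:R * d k) <= C * d k * M by rewrite ler_wpM2l // mulr_ge0.
  have -> : (m * B + C * M) *: (d k : R^o) = (m * B + C * M) * d k by [].
  rewrite -natr1 mulrDl mul1r in h2 *.
  nra.
have mkG0 : m * (k%:R * d k) * G k @[k --> \oo] --> (0 : R).
  apply: (@squeeze_cvgr _ _ _ _ (fun=> 0) (fun k => m * B * (k%:R * d k))).
  - near=> k; have /andP[? ?] := GB k; rewrite !mulr_ge0 //=.
    by rewrite -mulrA [leRHS]mulrAC -!mulrA !ler_wpM2l // mulrC ler_wpM2l // mulr_ge0.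
  - exact: cvg_cst.
  - by rewrite -[0](mulr0 (m * B)); apply: cvgMr.
have kAE : (fun k => k%:R * A k) = a - (fun k => m * (k%:R * d k) * G k).
  by apply/funext => k; rewrite !fctE /a; ring.
have kAcvg : cvgn (fun k => k%:R * A k).
  by rewrite kAE; apply: is_cvgB => //; apply: cvgP mkG0.
by rewrite -(summable_harmonic_cvg0 A0 Acvg kAcvg).
Unshelve. all: by end_near. Qed.

End RealSequences.

(** * Inverse powers *)

Section PowerSequences.
Context {R : realType}.
Implicit Types (x y c a p delta : R).

Lemma powRN_noninc x y p : 0 < x -> x <= y -> 0 <= p -> (y `^ p)^-1 <= (x `^ p)^-1.
Proof.
move=> x0 xy p0; rewrite lef_pV2 ?posrE ?powR_gt0 ?(lt_le_trans x0) //.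
by apply: ge0_ler_powR => //; rewrite nnegrE ltW ?(lt_le_trans x0).
Qed.

(** The arithmetic-geometric inequality and x (x + 2) <= (x + 1)^2: log-convexity
    of the power replaces a second derivative. *)
Lemma powRN_midconvex x p : 0 < x -> 0 <= p ->
  2 * ((x + 1) `^ p)^-1 <= (x `^ p)^-1 + ((x + 2) `^ p)^-1.
Proof.
move=> x0 p0.
have x1 : 0 < x + 1 by lra.
have x2 : 0 < x + 2 by lra.
set u := (x `^ p)^-1; set v := ((x + 2) `^ p)^-1; set w := (_ `^ p)^-1.
have u0 : 0 < u by rewrite invr_gt0 powR_gt0.
have v0 : 0 < v by rewrite invr_gt0 powR_gt0.
have w0 : 0 < w by rewrite invr_gt0 powR_gt0.
have wuv : w ^+ 2 <= u * v.
  rewrite /w /u /v expr2 -!invfM -!powRM ?(ltW x0) ?(ltW x1) ?(ltW x2) //.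
  by apply: powRN_noninc => //; [exact: mulr_gt0|nra].
have : (2 * w) ^+ 2 <= (u + v) ^+ 2.
  by have := sqr_ge0 (u - v); rewrite !expr2 in wuv *; lra.
by rewrite ler_sqr // nnegrE; lra.
Qed.

(** From (1 - 1/x)^-alpha >= exp (alpha / x) >= 1 + alpha / x.  It bounds the terms
    of a convergent p-series by telescoping differences. *)
Lemma powRN_telescope x alpha : 1 < x -> 0 < alpha ->
  alpha * (x `^ (1 + alpha))^-1 <= ((x - 1) `^ alpha)^-1 - (x `^ alpha)^-1.
Proof.
move=> x1 al0; have x0 : 0 < x by lra.
have xm0 : 0 < x - 1 by lra.
rewrite powRD ?powRr1 ?(ltW x0)//; last by rewrite (gt_eqF x0) implybT.
rewrite invfM.
have powVE y : 0 < y -> (y `^ alpha)^-1 = expR (- (alpha * ln y)).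
  by move=> y0; rewrite /powR gt_eqF // expRN.
set u := (x `^ alpha)^-1.
have u0 : 0 < u by rewrite invr_gt0 powR_gt0.
have xV : x^-1 <= ln x - ln (x - 1).
  rewrite -[leRHS]opprB lerNr -ln_div ?posrE //.
  have -> : (x - 1) / x = 1 + - x^-1 by rewrite mulrBl mul1r mulfV ?gt_eqF.
  by apply: le_ln1Dx; rewrite ltrN2 invf_lt1.
have H : u * (1 + alpha / x) <= ((x - 1) `^ alpha)^-1.
  apply: (@le_trans _ _ (u * expR (alpha * (ln x - ln (x - 1))))).
    rewrite ler_wpM2l ?(ltW u0) //; apply: le_trans (expR_ge1Dx _).
    by rewrite lerD2l ler_wpM2l // (ltW al0).
  by rewrite /u !powVE // -expRD ler_expR; lra.
have -> : alpha * (x^-1 * u) = u * (1 + alpha / x) - u by ring.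
lra.
Qed.

Lemma powRN_summable a p : 0 < a -> 1 < p ->
  cvgn (series (fun k : nat => ((k%:R + a) `^ p)^-1)).
Proof.
move=> a0 p1; have al0 : 0 < p - 1 by lra.
have ka k : 0 < k%:R + a :> R by rewrite ltr_wpDl.
set u := fun k : nat => _.
have u0 k : 0 <= u k by rewrite invr_ge0 powR_ge0.
apply: (@nnseries_bounded_cvgn _ _ (u 0 + (p - 1)^-1 * (a `^ (p - 1))^-1)) => // -[|n].
  by rewrite seriesEnat /= big_geq // addr_ge0 // mulr_ge0 ?invr_ge0 ?powR_ge0 ?ltW.
rewrite seriesEnat /= big_nat_recl // lerD2l ler_pdivlMl // mulr_sumr.
pose v (k : nat) := ((k%:R + a) `^ (p - 1))^-1.
apply: (@le_trans _ _ (\sum_(0 <= k < n) (v k - v k.+1))).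
  apply: ler_sum_nat => k _.
  have := @powRN_telescope (k.+1%:R + a) (p - 1) _ al0; rewrite /u /v -natr1.
  have -> : 1 + (p - 1) = p by ring.
  have -> : k%:R + 1 + a - 1 = k%:R + a :> R by ring.
  by apply; have := ka k; lra.
rewrite (@telescope_sumr_eq _ 0 n (fun k => - v k)) ?leq0n //; last first.
  by move=> k _; rewrite opprK addrC.
by rewrite opprK /v add0r addrC gerDl oppr_le0 invr_ge0 powR_ge0.
Qed.

Lemma powRN_cvg0 (a p : R) : 0 < a -> 0 < p ->
  ((k%:R + a) `^ p)^-1 @[k --> \oo] --> (0 : R).
Proof.
move=> a0 p0; apply/cvgr0Pnorm_le => e e0; near=> k.
have ka : 0 < k%:R + a :> R by rewrite ltr_wpDl.
rewrite ger0_norm ?invr_ge0 ?powR_ge0 // -[leRHS]invrK lef_pV2 ?posrE ?invr_gt0 ?powR_gt0 //.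
have -> : e^-1 = (e^-1 `^ p^-1) `^ p.
  by rewrite -powRrM mulVf ?gt_eqF // powRr1 // invr_ge0 ltW.
apply: ge0_ler_powR; rewrite ?(ltW p0) ?nnegrE ?powR_ge0 ?(ltW ka) //.
apply: (@le_trans _ _ k%:R); last by rewrite lerDl ltW.
by near: k; apply: nbhs_infty_ger; exact: num_real.
Unshelve. all: by end_near. Qed.

End PowerSequences.

(** * Limits along filters on the indices *)

Section RealLimits.
Context {R : realType}.

(** Comparing values on a segment near one of its end points always ends with
    letting the parameter t tend to 0 in an inequality of this form. *)
Lemma le_of_segment (b c d : R) :
  (forall t, 0 < t <= 1 -> b <= c + t * d) -> b <= c.
Proof.
move=> H; rewrite leNgt; apply/negP => cb.
have d0 : 0 < d by have := H 1; rewrite ltr01 lexx mul1r => /(_ isT); lra.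
(* small enough for t * d to be at most half of b - c *)
pose t := Num.min 1 ((b - c) / (2 * d)).
have t0 : 0 < t by rewrite /t lt_min ltr01 divr_gt0 //; lra.
have t1 : t <= 1 by rewrite /t ge_min lexx.
have := H t; rewrite t0 t1 => /(_ isT).
have : t * d <= (b - c) / 2.
  have -> : (b - c) / 2 = ((b - c) / (2 * d)) * d by field; lra.
  by rewrite ler_wpM2r ?(ltW d0) // /t ge_min lexx orbT.
lra.
Qed.

Lemma ultra_bounded_cvg (U : set_system nat) (u : nat -> R) M :
  UltraFilter U -> (forall k, `|u k| <= M) -> cvg (u @ U).
Proof.
move=> UU uM.
have [|p [_ clp]] := @segment_compact R (- M) M (u @ U) (fmap_proper_filter u _).
  by apply: (@filterE _ U) => k /=; rewrite in_itv /= -ler_norml.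
apply/cvg_ex; exists p => B Bp.
have [//|nB] := in_ultra_setVsetC (u @^-1` B) UU.
by have [q [Bq nBq]] := clp (~` B) B nB Bp.
Qed.

(** If the convergence fails for a neighbourhood B, the indices outside B generate
    with F a proper filter, and an ultrafilter above it contradicts the hypothesis. *)
Lemma ultra_cvg_nbhs (F : set_system nat) (FF : ProperFilter F) (u : nat -> R) (l : R) :
  (forall U, UltraFilter U -> F `<=` U -> u k @[k --> U] --> l) ->
  u k @[k --> F] --> l.
Proof.
move=> H B Bl; apply: contrapT => nFB.
pose G := within (u @^-1` (~` B)) F.
have GP : ProperFilter G.
  apply: Build_ProperFilter_ex => A GA.
  apply: contrapT => nA; apply: nFB; move: GA; rewrite /G /within /=.
  apply: filterS => k Hk; apply: contrapT => nBk.
  by apply: nA; exists k; apply: Hk.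
have [U [UU GU]] := ultraFilterLemma GP.
have UF : F `<=` U by move=> A FA; apply: GU; apply: filterS FA.
have UB : U (u @^-1` B) by exact: (H U UU UF B Bl).
have UnB : U (u @^-1` (~` B)).
  by apply: GU; rewrite /G /within /=; exact: (@filterE _ F).
have UP : ProperFilter U by exact: ultra_proper.
apply: (@filter_not_empty _ U); rewrite -(setICr (u @^-1` B)).
exact: (filterI UB UnB).
Qed.

End RealLimits.

(** * Hilbert space: representation, weak limits, Opial's lemma *)

Section InnerProduct.
Context {R : realType} {E : completeNormedModType R}.
Variable dot : {dot E for @idfun R}.
Hypothesis dot_norm : forall x : E, dot x x = `|x| ^+ 2.
Implicit Types (u v w x z p : E).

Lemma dotC u v : dot u v = dot v u.
Proof. by rewrite hermC expr0 mul1r. Qed.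

Lemma dotDl u v w : dot (u + v) w = dot u w + dot v w.
Proof. exact: linearDl. Qed.

Lemma dotDr u v w : dot u (v + w) = dot u v + dot u w.
Proof. exact: linearDr. Qed.

Lemma dotNl u v : dot (- u) v = - dot u v.
Proof. exact: linearNl. Qed.

Lemma dotNr u v : dot u (- v) = - dot u v.
Proof. exact: linearNr. Qed.

Lemma dotZl (t : R) u v : dot (t *: u) v = t * dot u v.
Proof. exact: linearZl_LR. Qed.

Lemma dotZr (t : R) u v : dot u (t *: v) = t * dot u v.
Proof. exact: linearZr_LR. Qed.

Definition dotE := (dotDl, dotDr, dotNl, dotNr, dotZl, dotZr).

Lemma sqr_normD u v : `|u + v| ^+ 2 = `|u| ^+ 2 + 2 * dot u v + `|v| ^+ 2.
Proof. by rewrite -!dot_norm !dotE (dotC v u); ring. Qed.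

Lemma sqr_normB u v : `|u - v| ^+ 2 = `|u| ^+ 2 - 2 * dot u v + `|v| ^+ 2.
Proof. by rewrite -!dot_norm !dotE (dotC v u); ring. Qed.

Lemma cauchy_schwarz u v : dot u v <= `|u| * `|v|.
Proof.
have [->|v0] := eqVneq v 0.
  by rewrite normr0 mulr0 -(scale0r 0) dotZr mul0r.
have nv : 0 < `|v| by rewrite normr_gt0.
have := sqr_ge0 `| `|v| ^+ 2 *: u - dot u v *: v |.
rewrite -[X in 0 <= X]dot_norm !dotE (dotC v u) !dot_norm => H.
have {}H : 0 <= `|v| ^+ 2 * ((`|v| * `|u|) ^+ 2 - dot u v ^+ 2) by lra.
rewrite pmulr_rge0 ?exprn_gt0 // subr_ge0 in H.
have [duv|duv] := leP (dot u v) 0.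
  by apply: le_trans duv _; exact: mulr_ge0.
by rewrite mulrC -ler_sqr ?nnegrE ?(ltW duv) ?mulr_ge0.
Qed.

Lemma abs_dot_le u v : `|dot u v| <= `|u| * `|v|.
Proof.
by rewrite ler_norml cauchy_schwarz lerNl -dotNl -(normrN u) cauchy_schwarz.
Qed.

(** Minimize |u|^2 - 2 l(u) over C.  The parallelogram identity makes minimizing
    sequences Cauchy, and the stated inequality is the first order condition at the
    minimizer.  With C the whole space this is Riesz's representation theorem; with
    l = <a, .> it is the projection of a on C. *)
Lemma stampacchia (C : set E) (l : E -> R) (M : R) :
    C !=set0 -> closed C ->
    (forall u v t, C u -> C v -> 0 <= t <= 1 -> C (t *: u + (1 - t) *: v)) ->
    (forall t u v, l (t *: u + v) = t * l u + l v) ->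
    (forall u, `|l u| <= M * `|u|) ->
  exists2 p, C p & forall u, C u -> l (u - p) <= dot p (u - p).
Proof.
move=> [c Cc] Cclosed Cconvex llin lM.
have lD u v : l (u + v) = l u + l v by have := llin 1 u v; rewrite scale1r mul1r.
have l0 : l 0 = 0 by have := lD 0 0; rewrite addr0; lra.
have lZ t u : l (t *: u) = t * l u by have := llin t u 0; rewrite l0 !addr0.
have lB u v : l (u - v) = l u - l v by rewrite -(scaleN1r v) lD lZ; lra.
pose Q u := `|u| ^+ 2 - 2 * l u.
have QM u : - M ^+ 2 <= Q u.
  have := lM u; rewrite ler_norml => /andP[_ H].
  by have := sqr_ge0 (`|u| - M); rewrite /Q; nra.
have QC : has_inf [set Q u | u in C].
  by split; [exists (Q c), c|exists (- M ^+ 2) => _ [u _ <-]].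
set m := inf [set Q u | u in C].
have mQ u : C u -> m <= Q u.
  by move=> Cu; apply: (inf_lbound QC.2); exists u.
have Qmin (n : nat) : exists u, C u /\ Q u < m + harmonic n.
  have [_ [u Cu <-] ?] := inf_adherent (harmonic_gt0 n : 0 < harmonic n :> R) QC.
  by exists u.
pose u n := projT1 (cid (Qmin n)).
have Cu n : C (u n) by exact: (projT2 (cid (Qmin n))).1.
have Qu n : Q (u n) < m + harmonic n by exact: (projT2 (cid (Qmin n))).2.
have umid i j : `|u i - u j| ^+ 2 <= 2 * (harmonic i + harmonic j).
  have h01 : 0 <= (2^-1 : R) <= 1 by lra.
  have := mQ _ (Cconvex _ _ 2^-1 (Cu i) (Cu j) h01).
  have := Qu i; have := Qu j; rewrite /Q lD !lZ sqr_normB sqr_normD !dotZl !dotZr.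
  by rewrite !normrZ !exprMn !real_normK ?num_real //; lra.
have [p up] : exists p, u @ \oo --> p.
  apply/cvg_ex; apply/cauchy_cvgP; apply/cauchy_exP => e e0.
  have : \forall n \near \oo, harmonic n < e ^+ 2 / 4.
    by apply: (cvgr_lt _ (@cvg_harmonic R)); rewrite divr_gt0 ?exprn_gt0.
  move=> [N _ HN]; exists (u N); exists N => // n /= Nn.
  rewrite -ball_normE /ball_ /= -ltr_sqr ?nnegrE ?(ltW e0) //.
  apply: le_lt_trans (umid _ _) _.
  have h1 : harmonic N < e ^+ 2 / 4 := HN N (leqnn N).
  have h2 : harmonic n < e ^+ 2 / 4 := HN n Nn.
  lra.
have Cp : C p by apply: (@closed_cvg _ _ _ _ u C Cclosed _ p up); exact: nearW.
have Qpm : Q p <= m.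
  have H1 : m + harmonic n + (2 * `|p| + 2 * M) * `|p - u n| @[n --> \oo]
      --> m + 0 + (2 * `|p| + 2 * M) * `|p - p|.
    apply: cvgD; first by apply: cvgD; [exact: cvg_cst|exact: cvg_harmonic].
    by apply: cvgMr; apply: cvg_norm; apply: cvgB => //; exact: cvg_cst.
  rewrite subrr normr0 mulr0 !addr0 in H1.
  apply: (cvgr_to_ge H1); near=> n.
  have := Qu n; have := lM (p - u n); rewrite ler_norml lB => /andP[h _].
  have := cauchy_schwarz p (p - u n).
  have := sqr_ge0 `|p - u n|.
  rewrite /Q sqr_normB dotDr dotNr dot_norm; lra.
exists p => // v Cv.
apply: (@le_of_segment _ _ _ (`|v - p| ^+ 2 / 2)) => t /andP[t0 t1].
have t01 : 0 <= t <= 1 by rewrite t1 ltW.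
have := mQ _ (Cconvex _ _ t Cv Cp t01).
have -> : t *: v + (1 - t) *: p = p + t *: (v - p).
  by rewrite scalerBr scalerBl scale1r addrCA addrA.
rewrite /Q sqr_normD lD lZ dotZr normrZ exprMn real_normK ?num_real // => H.
have {}H : 0 <= t * (2 * dot p (v - p) + t * `|v - p| ^+ 2 - 2 * l (v - p)).
  by rewrite /Q in Qpm; lra.
by rewrite pmulr_rge0 // in H; lra.
Unshelve. all: by end_near. Qed.

(** Weak convergence along an arbitrary filter, so that ultrafilters can play the
    role of subsequences. *)
Definition weak_limit (F : set_system nat) (x : nat -> E) (l : E) :=
  forall v, dot (x k) v @[k --> F] --> dot l v.

(** Scalar products converge along U by compactness of segments; their limit is a
    bounded linear functional of v, which a vector represents. *)
Lemma ultra_weak_limit (U : set_system nat) (x : nat -> E) (M : R) :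
  UltraFilter U -> (forall k, `|x k| <= M) -> exists l, weak_limit U x l.
Proof.
move=> UU xM.
have dM v k : `|dot (x k) v| <= M * `|v|.
  by apply: le_trans (abs_dot_le _ _) _; rewrite ler_wpM2r.
have dcvg v : cvg (dot (x k) v @[k --> U]) by exact: ultra_bounded_cvg (dM v).
pose l v := lim (dot (x k) v @[k --> U]).
have llin t u w : l (t *: u + w) = t * l u + l w.
  apply/cvg_lim => //.
  rewrite (_ : (fun k => _) = (fun k => t * dot (x k) u + dot (x k) w)).
    by apply: cvgD; [apply: cvgMr|]; exact: dcvg.
  by apply/funext => k; rewrite !dotE.
have lM v : `|l v| <= M * `|v|.
  rewrite ler_norml; apply/andP; split.
    by apply: limr_ge => //; apply: nearW => k; have := dM v k; rewrite ler_norml => /andP[].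
  by apply: limr_le => //; apply: nearW => k; have := dM v k; rewrite ler_norml => /andP[].
have [p _ lp] := @stampacchia setT l M (ex_intro _ 0 I) closedT (fun _ _ _ _ _ _ => I) llin lM.
have lE v : l v = dot p v.
  have le1 w : l w <= dot p w.
    by have := lp (w + p) I; rewrite addrK.
  apply/eqP; rewrite eq_le le1 /=.
  have := le1 (- v); have l0 := llin 1 0 0; rewrite scaler0 addr0 in l0.
  have := llin (-1) v 0; rewrite scaleN1r addr0 dotNr; lra.
by exists p => v; rewrite -lE; exact: dcvg.
Qed.

(** Sublevel sets are closed and convex.  The projection p of l on one of them
    satisfies <l - p, x_k - p> <= 0, hence <l - p, l - p> <= 0 in the limit. *)
Lemma weak_lsc (F : set_system nat) (x : nat -> E) (l : E) (phi : E -> \bar R)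
    (alpha : nat -> R) (beta : R) :
    ProperFilter F -> convex_efun phi -> lower_semicontinuous phi ->
    weak_limit F x l -> alpha @ F --> beta ->
    (\forall k \near F, (phi (x k) <= (alpha k)%:E)%E) ->
  (phi l <= beta%:E)%E.
Proof.
move=> FF phic phil xl ab phia.
apply/lee_addgt0Pr => e e0; rewrite -EFinD.
pose C := [set u | (phi u <= (beta + e)%:E)%E].
have FC : \forall k \near F, C (x k).
  have : \forall k \near F, alpha k <= beta + e.
    by apply: (cvgr_le _ ab); rewrite ltrDl.
  by apply: filterS2 phia => k h1 h2; apply: le_trans h1 _; rewrite lee_fin.
have Cclosed : closed C.
  have -> : C = ~` [set u | (phi u > (beta + e)%:E)%E].
    by apply/seteqP; split => u; rewrite /C /= leNgt => /negP.
  by apply: open_closedC; apply: (lower_semicontinuousP phi).1.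
have Cconvex u v t : C u -> C v -> 0 <= t <= 1 -> C (t *: u + (1 - t) *: v).
  move=> Cu Cv t01; apply: le_trans (phic _ _ _ t01) _.
  have /andP[t0 t1] := t01.
  have -> : beta + e = t * (beta + e) + (1 - t) * (beta + e) by ring.
  by rewrite [leRHS]EFinD (EFinM t) (EFinM (1 - t)) leeD // lee_wpmul2l ?lee_fin ?subr_ge0.
have [c Cc] := @filter_ex _ F _ _ FC.
have [|||p Cp proj] := @stampacchia C (dot l) `|l| _ Cclosed Cconvex.
- by exists (x c).
- by move=> t u v; rewrite !dotE.
- by move=> u; exact: abs_dot_le.
suff -> : l = p by [].
have : dot (l - p) (l - p) <= 0.
  have H : dot (x k) (l - p) - dot p (l - p) @[k --> F] --> dot l (l - p) - dot p (l - p).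
    by apply: cvgB; [exact: xl|exact: cvg_cst].
  rewrite dotDl dotNl; apply: (cvgr_to_le H).
  apply: filterS FC => k /proj; rewrite -subr_le0 !dotE !(dotC _ (x k)) !(dotC p l); lra.
rewrite dot_norm => h; apply/eqP; rewrite -subr_eq0 -normr_eq0 -sqrf_eq0.
by rewrite eq_le h sqr_ge0.
Qed.

Lemma bounded_of_dist_cvg (x : nat -> E) z : cvgn (fun k => `|x k - z| ^+ 2) ->
  exists M, forall k, `|x k| <= M.
Proof.
move=> /cvgn_bounded [M xM]; exists (M + 1 + `|z|) => k; rewrite -lerBlDr.
apply: (@le_trans _ _ `|x k - z|).
  by rewrite lerBlDr -[X in `|X| <= _](subrK z (x k)); exact: ler_normD.
(* t <= t^2 + 1 for every real t *)
have := xM k; rewrite ger0_norm ?sqr_ge0 // => xkM.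
have := sqr_ge0 (`|x k - z| - 1); have := sqr_ge0 `|x k - z|; lra.
Qed.

(** Two weak limits l, l' along ultrafilters have distances to x_k that converge
    along the whole sequence, hence so does <x_k, l - l'>; computing this limit along
    either ultrafilter gives <l, l - l'> = <l', l - l'>. *)
Lemma opial (x : nat -> E) (S : set E) : S !=set0 ->
    (forall z, S z -> cvgn (fun k => `|x k - z| ^+ 2)) ->
    (forall U l, UltraFilter U -> \oo `<=` U -> weak_limit U x l -> S l) ->
  exists2 l, S l & weakly_cvg dot x l.
Proof.
move=> [z0 Sz0] Scvg Sl.
have [M xM] := bounded_of_dist_cvg (Scvg _ Sz0).
have [U0 [UU0 sU0]] := @ultraFilterLemma _ \oo _.
have [l xl] := ultra_weak_limit UU0 xM.
have Sl0 : S l by exact: Sl UU0 sU0 xl.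
exists l => // v; apply: ultra_cvg_nbhs => U UU sU.
have [l' xl'] := ultra_weak_limit UU xM.
suff -> : l = l' by exact: xl'.
have Sl' : S l' by exact: Sl UU sU xl'.
have /cvg_ex[/= c dc] : cvgn (fun k => dot (x k) (l - l')).
  rewrite (_ : (fun k => _) =
      (fun k => 2^-1 * (`|x k - l'| ^+ 2 - `|x k - l| ^+ 2 + `|l| ^+ 2 - `|l'| ^+ 2))).
    apply: is_cvgMr; apply: is_cvgB; last exact: is_cvg_cst.
    by apply: is_cvgD; [apply: is_cvgB; exact: Scvg|exact: is_cvg_cst].
  by apply/funext => k; rewrite !sqr_normB dotDr dotNr; field.
have lim_along V w : UltraFilter V -> \oo `<=` V -> weak_limit V x w ->
    dot w (l - l') = c.
  move=> UV sV xw; rewrite -(cvg_lim (@norm_hausdorff _ _) (xw (l - l'))).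
  by apply: cvg_lim => // A /dc; exact: sV.
have c1 := lim_along _ _ UU0 sU0 xl.
have c2 := lim_along _ _ UU sU xl'.
apply/eqP; rewrite -subr_eq0 -normr_eq0 -sqrf_eq0 -dot_norm dotDl dotNl c1 c2.
by rewrite subrr.
Qed.

End InnerProduct.

(** * Gradients, proximal points and zeros of V + df *)

Section ConvexAnalysis.
Context {R : realType} {E : completeNormedModType R}.
Variable dot : {dot E for @idfun R}.
Hypothesis dot_norm : forall x : E, dot x x = `|x| ^+ 2.
Implicit Types (u v w x y z p : E).

Lemma lipschitzE (L : R) (T : E -> E) : L.-lipschitz T ->
  forall x y, `|T x - T y| <= L * `|x - y|.
Proof. by move=> TL x y; exact: (TL (x, y)). Qed.

(** The difference quotients along y - x are at most h y - h x by convexity. *)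
Lemma gradient_le (h : E -> R) (gradh : E -> E) :
    convex_function [set: convex_lmodType E] h -> is_gradient dot h gradh ->
  forall x y, h x + dot (gradh x) (y - x) <= h y.
Proof.
move=> hconv hgrad x y.
have [hdiff hd] := hgrad x.
rewrite -lerBrDl -hd -deriveE //.
have hder : derivable h x (y - x) by exact: diff_derivable.
have H : (fun t : R => t^-1 *: (h (t *: (y - x) + x) - h x)) @ 0^'+ --> 'D_(y - x) h x.
  apply: cvg_trans hder; apply: cvg_app => A A0.
  have {}A0 : nbhs (0 : R) (fun t => t != 0 -> A t) := A0.
  by apply: (@filterS _ (nbhs (0 : R)) _ _ _ _ A0) => t At t0; apply: At; rewrite gt_eqF.
apply: (cvgr_to_le H); near=> t.
have t0 : 0 < t by [].
have t1 : t < 1 by near: t; exact: nbhs_right_lt.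
have hconv_t : h (t *: y + (1 - t) *: x) <= t * h y + (1 - t) * h x.
  have := hconv (Itv01 (ltW t0) (ltW t1)) y x; rewrite !inE.
  exact.
rewrite -[t^-1 *: _]/(t^-1 * _) ler_pdivrMl //.
have -> : t *: (y - x) + x = t *: y + (1 - t) *: x.
  by rewrite scalerBr scalerBl scale1r -addrA; congr (_ + _); rewrite addrC.
lra.
Unshelve. all: by end_near. Qed.

Lemma subdiff_fine_le (phi : E -> \bar R) x u y :
  subdiff dot phi x u -> phi y \is a fin_num ->
  fine (phi x) + dot u (y - x) <= fine (phi y).
Proof.
move=> [phix H] phiy; rewrite -lee_fin EFinD !fineK //; exact: H.
Qed.

(** Compare u with (1 - t) u + t y and let t tend to 0.  The point x0 makes the
    minimal value finite, hence g u too. *)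
Lemma prox_subdiff (g : E -> \bar R) (s : R) z u x0 :
    0 < s -> convex_efun g -> (forall x, g x != -oo%E) -> g x0 \is a fin_num ->
    is_prox (fun v => s%:E * g v)%E z u ->
  subdiff dot g u (s^-1 *: (z - u)).
Proof.
move=> s0 gconv gNy gx0 prox.
have umin y : (s%:E * g u + (`|u - z| ^+ 2 / 2)%:E <=
               s%:E * g y + (`|y - z| ^+ 2 / 2)%:E)%E.
  have [_] : argmin_on setT (fun v => s%:E * g v + (`|v - z| ^+ 2 / 2)%:E)%E u.
    by rewrite prox.
  by move=> /(_ y I).
have gu : g u \is a fin_num.
  rewrite fin_numE gNy /=; apply/eqP => guy; have := umin x0.
  rewrite guy gt0_muley ?lte_fin // addye // leye_eq -(fineK gx0) -EFinM.
  by [].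
split => // y.
have [gy|] := boolP (g y \is a fin_num); last first.
  by rewrite fin_numE gNy /= negbK => /eqP ->; rewrite leey.
rewrite -(fineK gu) -(fineK gy) -EFinD lee_fin.
set a := fine (g u); set b := fine (g y).
suff : s * a + dot (z - u) (y - u) <= s * b.
  move=> H; rewrite (dotZl dot) -(ler_pM2l s0) mulrDr mulrA mulfV ?gt_eqF // mul1r.
  exact: H.
apply: (@le_of_segment _ _ _ (`|y - u| ^+ 2 / 2)) => t /andP[t0 t1].
have t01 : 0 <= t <= 1 by rewrite t1 ltW.
pose w := t *: y + (1 - t) *: u.
have gw : (g w <= (t * b + (1 - t) * a)%:E)%E.
  by have := gconv y u t t01; rewrite -(fineK gy) -(fineK gu) -!EFinM -EFinD.
have gwf : g w \is a fin_num.
  by rewrite fin_numE gNy /=; apply: contraTneq gw => ->; rewrite leye_eq.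
have := umin w; move: gw; rewrite -(fineK gwf) -(fineK gu) lee_fin -/a => gw.
rewrite -!EFinM -!EFinD lee_fin => H.
have wz : w - z = (u - z) + t *: (y - u).
  by rewrite /w scalerBl scale1r addrCA -scalerBr addrAC.
rewrite wz (sqr_normD dot_norm (u - z)) (dotZr dot) normrZ exprMn real_normK ?num_real // in H.
have -> : dot (z - u) (y - u) = - dot (u - z) (y - u) by rewrite -(dotNl dot) opprB.
have := ler_wpM2l (ltW s0) gw => {}gw.
have {}H : 0 <= t * (s * b - s * a + dot (u - z) (y - u) + t * (`|y - u| ^+ 2 / 2)).
  by lra.
by rewrite pmulr_rge0 // in H; lra.
Qed.

Section Minty.
Variables (V : E -> E) (LV : R) (f : E -> \bar R).
Hypotheses (V_mono : monotone_op dot V) (V_lip : LV.-lipschitz V).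
Hypotheses (f_proper : proper_efun f) (f_convex : convex_efun f).
Hypothesis f_lsc : lower_semicontinuous f.

(** Minty's trick: test the hypothesis at l + t (y - l), divide by t, and use the
    continuity of V as t tends to 0. *)
Lemma minty_zero l :
  (forall u, f u \is a fin_num -> (f l <= (fine (f u) + dot (V u) (u - l))%:E)%E) ->
  zer (sum_op dot V f) l.
Proof.
move=> H; have [fNy [x0 fx0]] := f_proper.
have fl : f l \is a fin_num.
  by rewrite fin_numE fNy /=; apply: contraTneq (H _ fx0) => ->; rewrite leye_eq.
exists (- V l); last by rewrite subrr.
split => // y.
have [fy|] := boolP (f y \is a fin_num); last first.
  by rewrite fin_numE fNy /= negbK => /eqP ->; rewrite leey.
rewrite -(fineK fl) -(fineK fy) -EFinD lee_fin.
set a := fine (f l); set b := fine (f y).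
apply: (@le_of_segment _ _ _ (`|LV| * `|y - l| ^+ 2)) => t /andP[t0 t1].
have t01 : 0 <= t <= 1 by rewrite t1 ltW.
pose w := t *: y + (1 - t) *: l.
have fw : (f w <= (t * b + (1 - t) * a)%:E)%E.
  by have := f_convex y l t01; rewrite -(fineK fy) -(fineK fl) -!EFinM -EFinD.
have fwf : f w \is a fin_num.
  by rewrite fin_numE fNy /=; apply: contraTneq fw => ->; rewrite leye_eq.
have := H w fwf; move: fw; rewrite -(fineK fwf) lee_fin => fw.
rewrite -(fineK fl) lee_fin -/a.
have wl : w - l = t *: (y - l).
  by rewrite /w scalerBl scale1r scalerBr -addrA [l - _ - _]addrAC subrr sub0r.
rewrite wl (dotZr dot) => h1.
have h2 : dot (V w - V l) (y - l) <= t * (`|LV| * `|y - l| ^+ 2).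
  apply: le_trans (cauchy_schwarz dot_norm _ _) _.
  have := lipschitzE V_lip w l; rewrite wl normrZ (gtr0_norm t0) => h.
  have := ler_wpM2r (normr_ge0 (y - l)) h => {}h.
  apply: le_trans h _.
  have : LV * (t * `|y - l|) * `|y - l| <= `|LV| * (t * `|y - l|) * `|y - l|.
    by rewrite ler_wpM2r // ler_wpM2r ?ler_norm // mulr_ge0 // ltW.
  by move/le_trans; apply; rewrite expr2; lra.
rewrite (dotDl dot) (dotNl dot) in h2; rewrite (dotNl dot).
have {}h1 : 0 <= t * (b - a + dot (V w) (y - l)) by lra.
rewrite pmulr_rge0 // in h1; lra.
Qed.

(** The graph of V + df is closed for weak convergence of the points and strong
    convergence of the images: monotonicity of V moves its argument from x_k to a
    fixed u, after which every term is either affine in x_k or weakly lower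
    semicontinuous, and [minty_zero] applies. *)
Lemma weak_limit_zero (F : set_system nat) (x zeta : nat -> E) (l : E) (M : R) :
    ProperFilter F -> (forall k, `|x k| <= M) -> weak_limit dot F x l ->
    (\forall k \near F, subdiff dot f (x k) (zeta k)) ->
    `|V (x k) + zeta k| @[k --> F] --> (0 : R) ->
  zer (sum_op dot V f) l.
Proof.
move=> FF xM xl xzeta res0; apply: minty_zero => u fu.
pose alpha k := fine (f u) + (`|V (x k) + zeta k| * (`|u| + M) + (dot (V u) u - dot (x k) (V u))).
apply: (@weak_lsc _ _ dot dot_norm F x l f alpha) => //.
  rewrite /alpha (dotDr dot) (dotNr dot) (dotC dot (V u) l) -[X in fine _ + X]add0r -(mul0r (`|u| + M)).
  apply: cvgD; first exact: cvg_cst.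
  apply: cvgD; first by apply: cvgMl.
  by apply: cvgB; [exact: cvg_cst|exact: xl].
apply: filterS xzeta => k xz.
have fx := xz.1; rewrite -(fineK fx) lee_fin /alpha.
have := subdiff_fine_le xz fu.
have := V_mono u (x k).
have h : - dot (V (x k) + zeta k) (u - x k) <= `|V (x k) + zeta k| * (`|u| + M).
  rewrite -(dotNl dot); apply: le_trans (cauchy_schwarz dot_norm _ _) _.
  rewrite normrN ler_wpM2l //; apply: le_trans (ler_normB _ _) _.
  by rewrite lerD2l.
move: h; rewrite !(dotE dot) (dotC dot (x k) (V u)); lra.
Qed.

End Minty.
End ConvexAnalysis.

(** * One extragradient step *)

Section ExtragradientStep.
Context {R : realType} {E : completeNormedModType R}.
Variable dot : {dot E for @idfun R}.
Hypothesis dot_norm : forall x : E, dot x x = `|x| ^+ 2.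
Implicit Types (u v w x y z p : E).

(** The two subgradient inequalities, of y against x' and of x' against u, are added;
    the cross term <Px - Py, x' - y> is absorbed by the squared steps as
    theta < 1 in applications. *)
Lemma energy_step (s theta gx gy gu : R) x y x' u Px Py : 0 < s -> 0 <= theta ->
    gy + dot (s^-1 *: (x - y) - Px) (x' - y) <= gx ->
    gx + dot (s^-1 *: (x - x') - Py) (u - x') <= gu ->
    s * `|Px - Py| <= theta * `|x - y| ->
  `|x' - u| ^+ 2 + (1 - theta) * (`|x - y| ^+ 2 + `|y - x'| ^+ 2)
    + 2 * s * (gy - gu + dot Py (y - u)) <= `|x - u| ^+ 2.
Proof.
move=> s0 th0 hy hx' lip.
have sE a b c : s * dot (s^-1 *: a - b) c = dot a c - s * dot b c.
  by rewrite !(dotE dot) mulrDr mulrA mulfV ?gt_eqF //; ring.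
have h1 : s * gy + (dot (x - y) (x' - y) - s * dot Px (x' - y)) <= s * gx.
  by rewrite -sE -mulrDr ler_pM2l.
have h2 : s * gx + (dot (x - x') (u - x') - s * dot Py (u - x')) <= s * gu.
  by rewrite -sE -mulrDr ler_pM2l.
have h3 : 2 * s * dot (Px - Py) (x' - y) <= theta * (`|x - y| ^+ 2 + `|x' - y| ^+ 2).
  have th : s * `|Px - Py| * `|x' - y| <= theta * `|x - y| * `|x' - y|.
    by rewrite ler_wpM2r.
  have := cauchy_schwarz dot_norm (Px - Py) (x' - y).
  have := ler_wpM2l th0 (sqr_ge0 (`|x - y| - `|x' - y|)); rewrite mulr0.
  move=> h4 h5; have := ler_wpM2l (ltW s0) h5; nra.
rewrite -(normrN (y - x')) opprB.
have e1 : 2 * dot (x - y) (x' - y) = `|x - y| ^+ 2 + `|x' - y| ^+ 2 - `|x - x'| ^+ 2.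
  by rewrite -!dot_norm !(dotE dot) (dotC dot y x) (dotC dot x' x) (dotC dot y x'); ring.
have e2 : 2 * dot (x - x') (u - x') = `|x - x'| ^+ 2 + `|x' - u| ^+ 2 - `|x - u| ^+ 2.
  by rewrite -!dot_norm !(dotE dot) (dotC dot u x) (dotC dot x' x) (dotC dot u x'); ring.
have e3 : dot Py (y - u) = dot (Px - Py) (x' - y) - dot Px (x' - y) - dot Py (u - x').
  by rewrite !(dotE dot); ring.
rewrite e3; nra.
Qed.

(** Here w and w' are the residuals before and after the step, z = (x - y) / s and
    z' = (x - x') / s.  Polarizing the scalar products in the hypothesis leaves only
    |w' - z'|^2, which the second hypothesis controls. *)
Lemma tangent_residual_step (theta : R) w w' z z' :
    0 <= dot (w - z) z + dot (z - w') z' ->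
    `|w' - z'| <= theta * `|z - z'| -> 0 <= theta ->
  `|w'| ^+ 2 <= `|w| ^+ 2 - `|w - z| ^+ 2 - (1 - theta ^+ 2) * `|z - z'| ^+ 2.
Proof.
move=> h lip th0.
have : `|w' - z'| ^+ 2 <= (theta * `|z - z'|) ^+ 2.
  by rewrite ler_sqr ?nnegrE ?mulr_ge0.
rewrite exprMn; move: h.
rewrite !(sqr_normB dot_norm) !(dotE dot) !dot_norm; lra.
Qed.

(** The middle hypothesis is the cyclic monotonicity of a subdifferential along
    x, y, x'; adding the monotonicity of the single-valued part turns it into a
    statement on residuals, the form that [tangent_residual_step] consumes. *)
Lemma tangent_cyclic (s : R) (xi zeta xi' Px Px' x y x' : E) : 0 < s ->
    zeta = s^-1 *: (x - y) - Px ->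
    dot xi (y - x) + dot zeta (x' - y) + dot xi' (x - x') <= 0 ->
    0 <= dot (Px - Px') (x - x') ->
  0 <= dot (Px + xi - s^-1 *: (x - y)) (s^-1 *: (x - y))
       + dot (s^-1 *: (x - y) - (Px' + xi')) (s^-1 *: (x - x')).
Proof.
move=> s0 zetaE cyc mono.
have -> : s^-1 *: (x - y) = Px + zeta by rewrite zetaE [Px + _]addrC subrK.
rewrite -(pmulr_rge0 _ s0).
have zE : s *: (Px + zeta) = x - y.
  by rewrite zetaE [Px + _]addrC subrK scalerA mulfV ?gt_eqF // scale1r.
have dE u v : s * dot u v = dot u (s *: v) by rewrite (dotZr dot).
(* s times the claim is the sum of the two hypotheses *)
rewrite mulrDr !dE zE scalerA mulfV ?gt_eqF // scale1r.
by move: cyc mono; rewrite !(dotE dot); lra.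
Qed.

(** The residual w is moved to w - d v by the change of regularization before the
    step.  In the cross term -2 d <w - d v, v>, write w - d v as
    (w - d v - z) + (z - z') + z': the first two parts are absorbed by the decrease
    already available, and -<z', v> is bounded by (a' - a) / s since v is a subgradient
    whose function takes the values a and a' at the two successive points. *)
Lemma residual_drift (kappa s d a a' : R) w w' v z z' :
    0 < s -> 0 <= d -> 0 < kappa ->
    `|w'| ^+ 2 <= `|w - d *: v| ^+ 2 - `|w - d *: v - z| ^+ 2 - kappa * `|z - z'| ^+ 2 ->
    a + dot v (- (s *: z')) <= a' ->
  `|w'| ^+ 2 <= `|w| ^+ 2 + 2 / s * d * (a' - a) + kappa^-1 * `|v| ^+ 2 * d ^+ 2.
Proof.
move=> s0 d0 k0 hw hv.
set W := w - d *: v in hw.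
have wE : `|W| ^+ 2 = `|w| ^+ 2 - 2 * (d * dot W v) - d ^+ 2 * `|v| ^+ 2.
  rewrite /W (sqr_normB dot_norm) normrZ exprMn real_normK ?num_real //.
  by rewrite !(dotE dot) dot_norm; ring.
have WE : dot W v = dot (W - z) v + dot (z - z') v + dot z' v.
  by rewrite -!(dotDl dot) -addrA !subrK.
have h1 : - 2 * d * dot (W - z) v <= `|W - z| ^+ 2 + d ^+ 2 * `|v| ^+ 2.
  have := sqr_ge0 `|(W - z) + d *: v|.
  rewrite (sqr_normD dot_norm (W - z)) normrZ exprMn real_normK ?num_real // (dotZr dot); lra.
have h2 : - 2 * d * dot (z - z') v <= kappa * `|z - z'| ^+ 2 + kappa^-1 * `|v| ^+ 2 * d ^+ 2.
  have := sqr_ge0 `|(z - z') + (d / kappa) *: v|.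
  rewrite (sqr_normD dot_norm (z - z')) normrZ exprMn real_normK ?num_real // (dotZr dot).
  move=> /(ler_wpM2l (ltW k0)); rewrite mulr0 => h.
  have e1 : kappa * (`|z - z'| ^+ 2 + 2 * (d / kappa * dot (z - z') v) + (d / kappa) ^+ 2 * `|v| ^+ 2)
    = kappa * `|z - z'| ^+ 2 + 2 * d * dot (z - z') v + kappa^-1 * `|v| ^+ 2 * d ^+ 2.
    by field; rewrite gt_eqF.
  by rewrite e1 in h; lra.
have h3 : - 2 * d * dot z' v <= 2 / s * d * (a' - a).
  have hv' : - dot z' v <= s^-1 * (a' - a).
    rewrite ler_pdivlMl // (dotC dot z'); rewrite (dotNr dot) (dotZr dot) in hv; lra.
  have := ler_wpM2l d0 hv'; have -> : 2 / s * d * (a' - a) = 2 * (d * (s^-1 * (a' - a))) by ring.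
  lra.
rewrite wE WE in hw; lra.
Qed.

End ExtragradientStep.

(** * Sums of extended-real convex functions *)

Section ERealFacts.
Context {R : realType} {E : completeNormedModType R}.

Lemma fin_num_addM (p q : \bar R) (e : R) : 0 < e -> p != -oo%E -> q != -oo%E ->
  ((p + e%:E * q)%E \is a fin_num) = (p \is a fin_num) && (q \is a fin_num).
Proof.
move=> e0; rewrite fin_numD.
by case: q => [q||]//; rewrite ?gt0_muley ?lte_fin.
Qed.

Lemma mule_ge0_neqNy (r : R) (p : \bar R) : 0 <= r -> p != -oo%E -> (r%:E * p != -oo)%E.
Proof.
rewrite le_eqVlt => /predU1P[<-|r0]; first by rewrite mul0e.
by case: p => [q||] // _; rewrite gt0_muley ?lte_fin.
Qed.

Lemma convex_efun_addZ (p q : E -> \bar R) (e : R) : 0 <= e ->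
    (forall u, p u != -oo%E) -> (forall u, q u != -oo%E) ->
    convex_efun p -> convex_efun q ->
  convex_efun (fun u => p u + e%:E * q u)%E.
Proof.
move=> e0 pNy qNy pc qc u v t t01; have /andP[t0 t1] := t01.
have t1' : 0 <= 1 - t by rewrite subr_ge0.
rewrite !muleDr ?ltninfty_adde_def ?inE ?ltNye ?mule_ge0_neqNy //.
rewrite addeACA; apply: leeD; first exact: pc.
rewrite !(muleCA _ e%:E) -muleDr ?ltninfty_adde_def ?inE ?ltNye ?mule_ge0_neqNy //.
by apply: lee_wpmul2l; [rewrite lee_fin|exact: qc].
Qed.

End ERealFacts.

(** * The regularized iteration *)

(** The real-valued substitute for both growth conditions: p ranges over the normal
    cone of the zeros at z, and f z is finite there.  Monotonicity of b turns
    summability into b_k = o(1 / k). *)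
Definition dual_gap_bound {R : realType} {E : completeNormedModType R}
    (dot : {dot E for @idfun R}) (V : E -> E) (f : E -> \bar R) (eps : nat -> R)
    (z p : E) (b : nat -> R) : Prop :=
  [/\ forall k, 0 <= b k, forall k, b k.+1 <= b k, cvgn (series b) &
     forall k u, f u \is a fin_num ->
       eps k * dot p (u - z) <= dot (u - z) (V u) + fine (f u) - fine (f z) + b k].

Section Bilevel.
Context {R : realType} {E : completeNormedModType R}.
Variable dot : {dot E for @idfun R}.
Hypothesis dot_norm : forall x : E, dot x x = `|x| ^+ 2.
Variables (h : E -> R) (gradh : E -> E) (Lh : R).
Hypotheses (h_convex : convex_function [set: convex_lmodType E] h)
  (h_grad : is_gradient dot h gradh) (gradh_lip : Lh.-lipschitz gradh).
Variables (V : E -> E) (LV : R).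
Hypotheses (V_mono : monotone_op dot V) (LV_gt0 : 0 < LV) (V_lip : LV.-lipschitz V).
Variables (fhat hhat : E -> \bar R).
Hypotheses (fhat_proper : proper_efun fhat) (fhat_convex : convex_efun fhat)
  (fhat_lsc : lower_semicontinuous fhat)
  (hhat_proper : proper_efun hhat) (hhat_convex : convex_efun hhat)
  (hhat_lsc : lower_semicontinuous hhat).
Let H x := ((h x)%:E + hhat x)%E.
Let Z := zer (sum_op dot V fhat).
Let opt := argmin_on Z H.
Hypothesis opt_cond : forall xs, opt xs ->
  exists2 u, subdiff dot H xs u & exists2 p, normal_cone dot Z xs p & u + p = 0.
Hypothesis hhat_bounded : forall B : set E, bounded_set B ->
  B `<=` [set x | subdiff dot hhat x !=set0] ->
  bounded_set (\bigcup_(x in B) subdiff dot hhat x).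
Variable eps : nat -> R.
Hypotheses (eps_gt0 : forall k, 0 < eps k) (eps_noninc : forall k, eps k.+1 <= eps k)
  (eps_convex : forall k, eps k.+1 - eps k.+2 <= eps k - eps k.+1)
  (eps_cvg0 : eps @ \oo --> (0 : R)).

Let f u := fine (fhat u).
Let Hr u := h u + fine (hhat u).
Let F z u := dot (u - z) (V u) + f u - f z.
Let dom u := fhat u \is a fin_num /\ hhat u \is a fin_num.

Hypothesis dual_gap : forall z p, opt z -> normal_cone dot Z z p ->
  exists b, dual_gap_bound dot V fhat eps z p b.

Lemma opt_dom z : opt z -> dom z.
Proof.
move=> oz; have [[u [fz _] _] _] := oz; split => //.
have [u0 [Hz _] _] := opt_cond oz.
by move: Hz; rewrite /H fin_numD => /andP[].
Qed.

Lemma HE u : hhat u \is a fin_num -> H u = (Hr u)%:E.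
Proof. by move=> hu; rewrite /H /Hr EFinD fineK. Qed.

(** As -V z is a subgradient of f at z, F z u >= <V u - V z, u - z>. *)
Lemma zero_gap_ge0 z u : Z z -> fhat u \is a fin_num -> 0 <= F z u.
Proof.
move=> [w wz w0] fu; have := subdiff_fine_le wz fu.
have -> : w = - V z by apply/eqP; rewrite -addr_eq0 addrC; apply/eqP.
have := V_mono u z; rewrite /F /f (dotC dot (u - z) (V u)) (dotDl dot) !(dotNl dot).
lra.
Qed.

(** Apply the dual bound to 2 p, with -p a subgradient of H at z: using only half of
    F to absorb the linear term keeps the other half, which is what makes the gap
    itself controllable. *)
Lemma gap_half z : opt z -> exists b : nat -> R,
  [/\ forall k, 0 <= b k, forall k, b k.+1 <= b k, cvgn (series b) &
     forall k u, dom u -> F z u / 2 <= F z u + eps k * (Hr u - Hr z) + b k].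
Proof.
move=> oz; have [u0 u0H [p Np u0p]] := opt_cond oz.
have N2p : normal_cone dot Z z (2 *: p).
  by move=> u Zu; rewrite (dotZl dot) pmulr_rle0 //; exact: Np.
have [b [b0 bdec bcvg bH]] := dual_gap oz N2p.
exists b; split => // k u [fu hu].
have [fz hz] := opt_dom oz.
have u0E : u0 = - p by apply/eqP; rewrite -addr_eq0; apply/eqP.
have h1 : Hr z - dot p (u - z) <= Hr u.
  have := subdiff_fine_le u0H (_ : H u \is a fin_num).
  by rewrite !HE // u0E (dotNl dot); apply.
have := bH k u fu; rewrite -/(F z u) (dotZl dot).
have := b0 k; have := ler_wpM2l (ltW (eps_gt0 k)) h1; lra.
Qed.

Section Iterates.
Variables (s : R) (x y xif xih : nat -> E).
Hypotheses (s_gt0 : 0 < s) (s_lt : s < LV^-1).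
Let Phi k u := V u + eps k *: gradh u.
Let g k u := (fhat u + (eps k)%:E * hhat u)%E.
Hypothesis y_prox : forall k,
  is_prox (fun u => s%:E * g k u)%E (x k - s *: Phi k (x k)) (y k).
Hypothesis xif_subdiff : forall k, subdiff dot fhat (x k.+1) (xif k.+1).
Hypothesis xih_subdiff : forall k, subdiff dot hhat (x k.+1) (xih k.+1).
Hypothesis x_step : forall k,
  s^-1 *: (x k - x k.+1) - Phi k (y k) = xif k.+1 + eps k *: xih k.+1.
Variable xs : E.
Hypothesis xs_opt : opt xs.

Let G k u := f u + eps k * fine (hhat u).
(* the subgradient of g_k at y_k provided by the proximal step *)
Let zeta k := s^-1 *: (x k - y k) - Phi k (x k).
(* residual of Phi_k + dg_k at x_{k+1}; residuals are indexed from x_1 on because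
   x_0 may lie outside the domain *)
Let w k := Phi k (x k.+1) + (xif k.+1 + eps k *: xih k.+1).
(* a subgradient of H at x_{k+1}, by [Hr_le] below *)
Let v k := gradh (x k.+1) + xih k.+1.

Lemma x_dom k : dom (x k.+1).
Proof. by split; [exact: (xif_subdiff k).1|exact: (xih_subdiff k).1]. Qed.

Lemma g_fin k u : g k u \is a fin_num <-> dom u.
Proof.
have [fNy _] := fhat_proper; have [hNy _] := hhat_proper.
by rewrite /g /dom fin_num_addM //; split => [/andP[]|[-> ->]].
Qed.

Lemma gE k u : dom u -> fine (g k u) = G k u.
Proof. by move=> [fu hu]; rewrite /g fineD ?fin_numM // fineM. Qed.

Lemma y_subdiff k : subdiff dot (g k) (y k) (zeta k).
Proof.
have [fNy _] := fhat_proper; have [hNy _] := hhat_proper.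
have gconv : convex_efun (g k) by apply: convex_efun_addZ => //; exact: ltW.
have gNy u : (g k u != -oo)%E.
  rewrite /g adde_eq_ninfty negb_or fNy /=; exact: mule_ge0_neqNy (ltW _) _.
have gxs : g k xs \is a fin_num by apply/g_fin; exact: opt_dom.
have := prox_subdiff dot_norm s_gt0 gconv gNy gxs (y_prox k).
rewrite [x k - _ - _]addrAC scalerBr scalerA mulVf ?gt_eqF // scale1r.
exact.
Qed.

Lemma y_dom k : dom (y k).
Proof. exact/(g_fin k)/(y_subdiff k).1. Qed.

Lemma y_le k u : dom u -> G k (y k) + dot (zeta k) (u - y k) <= G k u.
Proof.
move=> du; have := subdiff_fine_le (y_subdiff k) (_ : g k u \is a fin_num).
by rewrite !gE //; [apply; exact/g_fin|exact: y_dom].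
Qed.

Lemma x_le j k u : dom u ->
  G j (x k.+1) + dot (xif k.+1 + eps j *: xih k.+1) (u - x k.+1) <= G j u.
Proof.
move=> [fu hu]; have h1 := subdiff_fine_le (xif_subdiff k) fu.
have h2 := ler_wpM2l (ltW (eps_gt0 j)) (subdiff_fine_le (xih_subdiff k) hu).
by rewrite /G /f (dotDl dot) (dotZl dot); lra.
Qed.

Lemma Hr_le k u : dom u -> Hr (x k.+1) + dot (v k) (u - x k.+1) <= Hr u.
Proof.
move=> [fu hu]; have h1 := subdiff_fine_le (xih_subdiff k) hu.
have h2 := gradient_le h_convex h_grad (x k.+1) u.
by rewrite /Hr (dotDl dot); lra.
Qed.

Lemma residualE j k :
  Phi j (x k.+1) + (xif k.+1 + eps j *: xih k.+1) = (V (x k.+1) + xif k.+1) + eps j *: v k.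
Proof. by rewrite /Phi /v scalerDr addrACA. Qed.

Lemma Phi_mono k a b : 0 <= dot (Phi k a - Phi k b) (a - b).
Proof.
have gmono : 0 <= dot (gradh a - gradh b) (a - b).
  have := gradient_le h_convex h_grad a b; have := gradient_le h_convex h_grad b a.
  by rewrite !(dotE dot); lra.
have := mulr_ge0 (ltW (eps_gt0 k)) gmono; have := V_mono a b.
by rewrite /Phi !(dotE dot); lra.
Qed.

(** The Lipschitz constant of Phi_k tends to that of V, and s LV < 1. *)
Lemma Phi_contraction : exists2 theta : R, 0 <= theta < 1 &
  exists K : nat, forall k, (K <= k)%N ->
    forall a b, s * `|Phi k a - Phi k b| <= theta * `|a - b|.
Proof.
have sL : s * LV < 1 by rewrite -ltr_pdivlMr // div1r.
have sL0 : 0 < s * LV by exact: mulr_gt0.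
exists ((1 + s * LV) / 2); first lra.
have [K _ HK] : \forall k \near \oo, eps k * (s * `|Lh|) <= (1 - s * LV) / 2.
  have : eps k * (s * `|Lh|) @[k --> \oo] --> 0 * (s * `|Lh|) by apply: cvgMl.
  by rewrite mul0r => /cvgr_le; apply; lra.
exists K => k Kk a b.
have h1 := lipschitzE V_lip a b; have h2 := lipschitzE gradh_lip a b.
have h3 := HK k Kk; rewrite /= in h3.
have e0 := ltW (eps_gt0 k).
have h4 : `|Phi k a - Phi k b| <= `|V a - V b| + eps k * `|gradh a - gradh b|.
  rewrite /Phi opprD addrACA -scalerBr; apply: le_trans (ler_normD _ _) _.
  by rewrite normrZ ger0_norm.
have h5 : `|gradh a - gradh b| <= `|Lh| * `|a - b|.
  by apply: le_trans h2 _; rewrite ler_wpM2r // ler_norm.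
have h6 := ler_wpM2l e0 h5.
have h7 : s * `|Phi k a - Phi k b| <= s * (LV * `|a - b| + eps k * (`|Lh| * `|a - b|)).
  by rewrite ler_pM2l //; lra.
apply: le_trans h7 _.
have := ler_wpM2r (normr_ge0 (a - b)) h3; lra.
Qed.

(** The energy inequality at u = z, where [gap_half] bounds the last term from
    below by -b_k. *)
Lemma fejer z : opt z -> cvgn (fun k => `|x k - z| ^+ 2) /\
  cvgn (series (fun k => `|x k - y k| ^+ 2 + `|y k - x k.+1| ^+ 2)).
Proof.
move=> oz; have dz := opt_dom oz.
have [b [b0 _ bcvg bH]] := gap_half oz.
have [theta /andP[th0 th1] [K HK]] := Phi_contraction.
have th1' : 0 < 1 - theta by rewrite subr_gt0.
pose S := fun k => `|x k - y k| ^+ 2 + `|y k - x k.+1| ^+ 2.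
have [xcvg Scvg] : cvgn (fun k => `|x k - z| ^+ 2) /\ cvgn (series ((1 - theta) *: S)).
  apply: (@quasi_fejer _ _ _ ((2 * s) *: b) K).
  - by move=> k; exact: sqr_ge0.
  - by move=> k; apply: mulr_ge0; [exact: ltW|rewrite addr_ge0 ?sqr_ge0].
  - exact: is_cvg_seriesZ.
  move=> k Kk.
  have yk := y_dom k.
  have hx := x_le k k dz; rewrite -x_step in hx.
  have := energy_step dot_norm s_gt0 th0 (y_le k (x_dom k)) hx (HK k Kk _ _).
  have hF := bH k _ yk.
  have F0 := zero_gap_ge0 oz.1 yk.1.
  have hg := ler_wpM2l (ltW (eps_gt0 k)) (gradient_le h_convex h_grad (y k) z).
  have hs : - b k <= G k (y k) - G k z + dot (Phi k (y k)) (y k - z).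
    move: hg hF F0; rewrite /G /Phi /F /Hr (dotC dot (y k - z)) !(dotE dot); lra.
  have := ler_wpM2l (ltW s_gt0) hs.
  rewrite !fctE -[_ *: (_ + _)]/(_ * _) -[_ *: b k]/(_ * _); lra.
split => //.
have -> : (fun k => `|x k - y k| ^+ 2 + `|y k - x k.+1| ^+ 2)
    = (1 - theta)^-1 *: ((1 - theta) *: S).
  by rewrite scalerA mulVf ?gt_eqF // scale1r.
exact: is_cvg_seriesZ.
Qed.

Lemma x_bounded : exists M, forall k, `|x k| <= M.
Proof. exact: bounded_of_dist_cvg (fejer xs_opt).1. Qed.

Lemma v_bounded : exists B, forall k, `|v k| <= B.
Proof.
have [M xM] := x_bounded.
have [B hB] : exists B, forall k, `|xih k.+1| <= B.
  have [||B [_ hB]] := hhat_bounded (B := [set x k.+1 | k in setT]).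
  - by exists M; split; [exact: num_real|move=> m /ltW Mm _ [k _ <-]; exact: le_trans (xM _) Mm].
  - by move=> _ [k _ <-]; exists (xih k.+1).
  exists (B + 1) => k; apply: hB; first by rewrite ltrDl.
  by exists (x k.+1) => //; exists k.
exists (`|Lh| * (M + `|xs|) + `|gradh xs| + B) => k.
rewrite /v; apply: le_trans (ler_normD _ _) (lerD _ (hB k)).
rewrite -(subrK (gradh xs) (gradh (x k.+1))); apply: le_trans (ler_normD _ _) _.
rewrite lerD2r; apply: le_trans (lipschitzE gradh_lip _ _) _.
apply: (@le_trans _ _ (`|Lh| * `|x k.+1 - xs|)); first by rewrite ler_wpM2r // ler_norm.
by rewrite ler_wpM2l //; apply: le_trans (ler_normB _ _) _; rewrite lerD2r.
Qed.

(** w_k = (x_k - x_{k+1}) / s + (Phi_k(x_{k+1}) - Phi_k(y_k)), and both terms are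
    bounded by the steps. *)
Lemma residual_summable : cvgn (series (fun k => `|w k| ^+ 2)).
Proof.
have [_ Scvg] := fejer xs_opt.
have [theta /andP[th0 th1] [K HK]] := Phi_contraction.
have [_] : cvgn (fun _ : nat => 0 : R) /\ cvgn (series (fun k => `|w k| ^+ 2)).
  apply: (@quasi_fejer _ _ _ ((8 * s^-1 ^+ 2) *:
    (fun k => `|x k - y k| ^+ 2 + `|y k - x k.+1| ^+ 2)) K) => //.
  - exact: is_cvg_seriesZ.
  move=> k Kk; rewrite !add0r !fctE -[_ *: (_ + _)]/(_ * _).
  set p := `|x k - y k|; set q := `|y k - x k.+1|.
  have wE : w k = s^-1 *: (x k - x k.+1) + (Phi k (x k.+1) - Phi k (y k)).
    by rewrite /w -x_step addrCA.
  have h1 : `|x k - x k.+1| <= p + q.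
    by rewrite -(subrK (y k) (x k)) -addrA; exact: ler_normD.
  have h2 : `|Phi k (x k.+1) - Phi k (y k)| <= s^-1 * q.
    rewrite ler_pdivlMl //; apply: le_trans (HK k Kk _ _) _.
    by rewrite /q (distrC (y k)) ler_piMl // ltW.
  have s0 : 0 < s^-1 by rewrite invr_gt0.
  have h3 : `|w k| <= s^-1 * (p + 2 * q).
    rewrite wE; apply: le_trans (ler_normD _ _) _.
    rewrite normrZ gtr0_norm //; have := ler_wpM2l (ltW s0) h1; lra.
  have p0 : 0 <= p by exact: normr_ge0.
  have q0 : 0 <= q by exact: normr_ge0.
  apply: (@le_trans _ _ ((s^-1 * (p + 2 * q)) ^+ 2)).
    by rewrite ler_sqr ?nnegrE // mulr_ge0 ?(ltW s0) //; lra.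
  rewrite exprMn -[leRHS]mulrA [leRHS]mulrCA ler_wpM2l ?sqr_ge0 //.
  by have := sqr_ge0 (p - q); have := sqr_ge0 p; have := sqr_ge0 q; lra.
by [].
Qed.

Lemma Hr_bounded z : opt z -> exists B, forall k, `|Hr (x k.+1) - Hr z| <= B.
Proof.
move=> oz; have [M xM] := x_bounded; have [B vB] := v_bounded.
have [b [b0 _ _ bH]] := gap_half oz.
have [u0 u0H _] := opt_cond oz.
exists ((B + `|u0|) * (M + `|z|)) => k.
have [fx hx] := x_dom k; have dz := opt_dom oz.
have h1 := Hr_le k dz.
have h2 : Hr z + dot u0 (x k.+1 - z) <= Hr (x k.+1).
  have := subdiff_fine_le u0H (_ : H (x k.+1) \is a fin_num).
  by rewrite !HE //; [apply|exact: dz.2].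
have h3 : `|x k.+1 - z| <= M + `|z|.
  by apply: le_trans (ler_normB _ _) _; rewrite lerD2r.
have h4 : - dot (v k) (z - x k.+1) <= B * (M + `|z|).
  rewrite -(dotNr dot) opprB; apply: le_trans (cauchy_schwarz dot_norm _ _) _.
  exact: ler_pM.
have h5 : - dot u0 (x k.+1 - z) <= `|u0| * (M + `|z|).
  rewrite -(dotNl dot) ; apply: le_trans (cauchy_schwarz dot_norm _ _) _.
  by rewrite normrN ler_wpM2l.
have MB0 : 0 <= M + `|z| by exact: le_trans h3.
have B0 : 0 <= B by exact: le_trans (vB 0).
have := mulr_ge0 B0 MB0; have := mulr_ge0 (normr_ge0 u0) MB0.
rewrite ler_norml; lra.
Qed.

(** [weighted_rate] for |w_k|^2, with weights d_k = eps_k - eps_{k+1} and with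
    G_k = B - (H(x_{k+1}) - H(xs)), shifted to be nonnegative. *)
Lemma residual_rate : k%:R * `|w k| ^+ 2 @[k --> \oo] --> (0 : R).
Proof.
have [B HB] := Hr_bounded xs_opt; have [Bv vB] := v_bounded.
have [theta /andP[th0 th1] [K HK]] := Phi_contraction.
have kap0 : 0 < 1 - theta ^+ 2 by nra.
have Bv0 : 0 <= Bv by exact: le_trans (vB 0).
pose d k := eps k - eps k.+1.
have d0 k : 0 <= d k by rewrite subr_ge0.
have dcvg : cvgn (series d).
  apply: (@nnseries_bounded_cvgn _ _ (eps 0)) => // n.
  rewrite seriesEnat /= (@telescope_sumr_eq _ 0 n (fun k => - eps k)) //.
    by rewrite opprK addrC gerDl oppr_le0 ltW.
  by move=> k _; rewrite opprK addrC.
apply: (@weighted_rate _ _ (fun k => B - (Hr (x k.+1) - Hr xs)) d (2 / s) (2 * B)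
  ((1 - theta ^+ 2)^-1 * Bv ^+ 2) K) => //.
- exact: residual_summable.
- by move=> k; have := HB k; rewrite ler_norml; lra.
- by rewrite divr_ge0 // ltW.
- by rewrite mulr_ge0 ?invr_ge0 ?sqr_ge0 // ltW.
move=> k Kk.
have -> : B - (Hr (x k.+1) - Hr xs) - (B - (Hr (x k.+2) - Hr xs)) = Hr (x k.+2) - Hr (x k.+1).
  by ring.
pose z := s^-1 *: (x k.+1 - y k.+1); pose z' := s^-1 *: (x k.+1 - x k.+2).
(* the residual of Phi_{k+1} + dg_{k+1} at the same point x_{k+1} *)
have WE : w k - d k *: v k = Phi k.+1 (x k.+1) + (xif k.+1 + eps k.+1 *: xih k.+1).
  by rewrite /w !residualE scalerBl opprB -addrA [eps k *: _ + _]addrCA subrr addr0.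
have wz' : `|w k.+1 - z'| <= theta * `|z - z'|.
  have -> : w k.+1 - z' = Phi k.+1 (x k.+2) - Phi k.+1 (y k.+1).
    by rewrite /w -x_step -/z' addrCA [LHS]addrC addKr.
  have -> : z - z' = s^-1 *: (x k.+2 - y k.+1).
    by rewrite -scalerBr opprB [X in _ *: X]addrC addrA subrK.
  rewrite normrZ gtr0_norm ?invr_gt0 // mulrCA ler_pdivlMl //.
  exact: HK (leqW Kk) _ _.
have cyc : 0 <= dot (w k - d k *: v k - z) z + dot (z - w k.+1) z'.
  rewrite WE; apply: (@tangent_cyclic _ _ dot s _ (zeta k.+1) (xif k.+2 + eps k.+1 *: xih k.+2)) => //.
    have := x_le k.+1 k (y_dom k.+1); have := y_le k.+1 (x_dom k.+1).
    have := x_le k.+1 k.+1 (x_dom k); lra.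
  exact: Phi_mono.
have hres := tangent_residual_step dot_norm cyc wz' th0.
have := residual_drift dot_norm s_gt0 (d0 k) kap0 hres (_ : Hr (x k.+1) + _ <= Hr (x k.+2)).
have -> : - (s *: z') = x k.+2 - x k.+1.
  by rewrite scalerA mulfV ?gt_eqF // scale1r opprB.
move=> /(_ (Hr_le k (x_dom k.+1))) H1; apply: le_trans H1 _.
rewrite lerD2l ler_wpM2r ?sqr_ge0 // ler_wpM2l ?invr_ge0 ?(ltW kap0) //.
by rewrite ler_sqr ?nnegrE.
Qed.

Lemma sqrt_residual_rate : Num.sqrt k.+1%:R * `|w k| @[k --> \oo] --> (0 : R).
Proof.
have kw : k.+1%:R * `|w k| ^+ 2 @[k --> \oo] --> (0 : R).
  rewrite (_ : (fun k => _) = (fun k => k%:R * `|w k| ^+ 2 + `|w k| ^+ 2)).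
    rewrite -[0]addr0; apply: cvgD; first exact: residual_rate.
    exact: cvg_series_cvg_0 residual_summable.
  by apply/funext => k; rewrite -natr1 mulrDl mul1r.
have -> : (fun k => Num.sqrt k.+1%:R * `|w k|)
    = (fun k => Num.sqrt (k.+1%:R * `|w k| ^+ 2)).
  by apply/funext => k; rewrite sqrtrM // sqrtr_sqr normr_id.
rewrite -[X in _ --> X]sqrtr0.
by apply: continuous_cvg kw; exact: sqrt_continuous.
Qed.

Lemma inclusion_residual_le : exists B, forall k,
  `|V (x k.+1) + xif k.+1| <= `|w k| + eps k * B.
Proof.
have [B vB] := v_bounded; exists B => k.
have -> : V (x k.+1) + xif k.+1 = w k - eps k *: v k by rewrite /w residualE addrK.
apply: le_trans (ler_normB _ _) _.
by rewrite normrZ gtr0_norm // lerD2l ler_pM2l.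
Qed.

(** The upper bound comes from testing the residual against x_{k+1} - z, the lower
    one from [gap_half]; sqrt (k + 1) b_k <= (k + 1) b_k -> 0. *)
Lemma gap_value_rates z : opt z ->
  Num.sqrt k.+1%:R * F z (x k.+1) @[k --> \oo] --> (0 : R) /\
  Num.sqrt k.+1%:R * (eps k * `|Hr (x k.+1) - Hr z|) @[k --> \oo] --> (0 : R).
Proof.
move=> oz; have dz := opt_dom oz.
have [M xM] := x_bounded.
have [b [b0 bdec bcvg bH]] := gap_half oz.
have bound k : F z (x k.+1) <= 2 * ((M + `|z|) * `|w k| + b k) /\
    eps k * `|Hr (x k.+1) - Hr z| <= 2 * ((M + `|z|) * `|w k| + b k).
  have h1 := subdiff_fine_le (xif_subdiff k) dz.1.
  have h2 := ler_wpM2l (ltW (eps_gt0 k)) (Hr_le k dz).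
  have h3 : dot (w k) (x k.+1 - z) <= (M + `|z|) * `|w k|.
    apply: le_trans (cauchy_schwarz dot_norm _ _) _; rewrite mulrC ler_wpM2r //.
    by apply: le_trans (ler_normB _ _) _; rewrite lerD2r.
  have h4 := bH k _ (x_dom k).
  have F0 := zero_gap_ge0 oz.1 (x_dom k).1.
  rewrite /w residualE in h3.
  have h5 : F z (x k.+1) + eps k * (Hr (x k.+1) - Hr z) <= (M + `|z|) * `|w k|.
    rewrite /w residualE; move: h1 h2 h3.
    rewrite /F /f (dotC dot (x k.+1 - z) (V _)) !(dotE dot); lra.
  have h6 := b0 k.
  have h7 : 0 <= (M + `|z|) * `|w k| by rewrite mulr_ge0 // addr_ge0 // (le_trans _ (xM 0)).
  split; first by lra.
  have [p0|p0] := leP 0 (Hr (x k.+1) - Hr z); first by rewrite ger0_norm //; lra.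
  by rewrite ltr0_norm //; lra.
have sb : Num.sqrt k.+1%:R * b k @[k --> \oo] --> (0 : R).
  have kb := noninc_summable_little b0 bdec bcvg.
  have b_0 : b @ \oo --> (0 : R) by exact: cvg_series_cvg_0.
  apply: (@squeeze_cvgr _ _ _ _ (fun=> 0) (fun k => k%:R * b k + b k)).
  - near=> k; rewrite mulr_ge0 ?sqrtr_ge0 //=.
    rewrite -[X in _ + X]mul1r -mulrDl natr1 ler_wpM2r //.
    rewrite -[leRHS]sqr_sqrtr // expr2 ler_peMl ?sqrtr_ge0 //.
    by rewrite -{1}sqrtr1 ler_sqrt // ler1n.
  - exact: cvg_cst.
  - by rewrite -[0]addr0; apply: cvgD.
have ub : Num.sqrt k.+1%:R * (2 * ((M + `|z|) * `|w k| + b k)) @[k --> \oo] --> (0 : R).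
  rewrite (_ : (fun k => _) = (fun k => 2 * (M + `|z|) * (Num.sqrt k.+1%:R * `|w k|)
      + 2 * (Num.sqrt k.+1%:R * b k))); last by apply/funext => k; ring.
  rewrite -[X in _ --> X](_ : 2 * (M + `|z|) * 0 + 2 * 0 = 0); last by rewrite !mulr0 addr0.
  by apply: cvgD; apply: cvgMr => //; exact: sqrt_residual_rate.
split; apply: (@squeeze_cvgr _ _ _ _ (fun=> 0) _ _ _ _ (cvg_cst _) ub); near=> k.
- rewrite mulr_ge0 ?sqrtr_ge0 ?ler_wpM2l ?sqrtr_ge0 ?(bound k).1 //=.
  exact: zero_gap_ge0 oz.1 (x_dom k).1.
- rewrite mulr_ge0 ?sqrtr_ge0 ?ler_wpM2l ?sqrtr_ge0 ?(bound k).2 //=.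
  by rewrite mulr_ge0 // ltW.
Unshelve. all: by end_near. Qed.

(** For weak lower semicontinuity of H only hhat needs [weak_lsc]: h is bounded
    below by its tangent at the weak limit, which is weakly continuous. *)
Lemma weak_convergence : Hr (x k.+1) @[k --> \oo] --> Hr xs ->
  exists2 l, opt l & weakly_cvg dot x l.
Proof.
move=> Hcvg; have [M xM] := x_bounded.
apply: (opial dot_norm) => [|z oz|U l UU sU xl].
- by exists xs.
- exact: (fejer oz).1.
have UP : ProperFilter U by exact: ultra_proper.
have alongU (u : nat -> R) (c : R) : u k.+1 @[k --> \oo] --> c -> u k @[k --> U] --> c.
  by rewrite cvg_shiftS => uc A /uc; exact: sU.
have U0 : \forall k \near U, (0 < k)%N by apply: sU; exact: nbhs_infty_gt.
have res0 : `|V (x k) + xif k| @[k --> U] --> (0 : R).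
  apply: (alongU (fun k => `|V (x k) + xif k|)) => /=.
  have [B resB] := inclusion_residual_le.
  apply: (@squeeze_cvgr _ _ _ _ (fun=> 0) (fun k => `|w k| + eps k * B)).
  - by near=> k; rewrite normr_ge0 resB.
  - exact: cvg_cst.
  have w0 : `|w k| @[k --> \oo] --> (0 : R).
    apply: (@squeeze_cvgr _ _ _ _ (fun=> 0) (fun k => Num.sqrt k.+1%:R * `|w k|)).
    - near=> k; rewrite normr_ge0 /= ler_peMl //.
      by rewrite -{1}sqrtr1 ler_sqrt // ler1n.
    - exact: cvg_cst.
    - exact: sqrt_residual_rate.
  rewrite -[X in _ --> X](_ : 0 + 0 * B = 0); last by rewrite mul0r addr0.
  by apply: cvgD => //; apply: cvgMl.
have Zl : Z l.
  apply: (@weak_limit_zero _ _ _ dot_norm V LV fhat _ _ _ _ _ U x xif l M) => //.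
  by apply: filterS U0 => -[//|k] _; exact: xif_subdiff.
have hl : (hhat l <= (Hr xs - h l)%:E)%E.
  apply: (@weak_lsc _ _ dot dot_norm U x l hhat
    (fun k => Hr (x k) - (h l + (dot (x k) (gradh l) - dot l (gradh l))))) => //.
    rewrite -[X in _ --> X](_ : Hr xs - (h l + (dot l (gradh l) - dot l (gradh l))) = _); last first.
      by rewrite subrr addr0.
    apply: cvgB; first exact: (alongU (fun k => Hr (x k))).
    apply: cvgD; first exact: cvg_cst.
    by apply: cvgB; [exact: xl|exact: cvg_cst].
  apply: filterS U0 => -[//|k] _.
  have hx := (x_dom k).2; rewrite -(fineK hx) lee_fin.
  have := gradient_le h_convex h_grad l (x k.+1).
  by rewrite /Hr (dotC dot (gradh l)) (dotDl dot) (dotNl dot); lra.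
split => // u Zu.
have [_ Hmin] := xs_opt; apply: le_trans (Hmin u Zu).
rewrite (HE (opt_dom xs_opt).2) /H.
have [hNy _] := hhat_proper.
have hlf : hhat l \is a fin_num.
  by rewrite fin_numE hNy /=; apply: contraTneq hl => ->; rewrite leye_eq.
by move: hl; rewrite -(fineK hlf) -EFinD !lee_fin; lra.
Unshelve. all: by end_near. Qed.

(** The estimates gathered without the auxiliary sequences; r stands for the norm of
    the residual w. *)
Lemma extragradient_rates :
  [/\ exists (r : R^nat) (B : R), [/\ 0 <= B,
         Num.sqrt k.+1%:R * r k @[k --> \oo] --> (0 : R) &
         forall k, `|V (x k.+1) + xif k.+1| <= r k + eps k * B],
      Num.sqrt k.+1%:R * (dot (x k.+1 - xs) (V (x k.+1)) + fine (fhat (x k.+1)) - fine (fhat xs))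
        @[k --> \oo] --> (0 : R),
      Num.sqrt k.+1%:R * (eps k * `|Hr (x k.+1) - Hr xs|) @[k --> \oo] --> (0 : R) &
      Hr (x k.+1) @[k --> \oo] --> Hr xs -> exists2 l, opt l & weakly_cvg dot x l].
Proof.
have [gap0 H0] := gap_value_rates xs_opt.
split=> //; last exact: weak_convergence.
have [B resB] := inclusion_residual_le.
exists (fun k => `|w k|), `|B|; split => //; first exact: sqrt_residual_rate.
by move=> k; apply: le_trans (resB k) _; rewrite lerD2l ler_pM2l // ler_norm.
Qed.

End Iterates.
End Bilevel.

(** * The growth conditions bound the dual gap *)

Section DualGap.
Context {R : realType} {E : completeNormedModType R}.
Variable dot : {dot E for @idfun R}.
Hypothesis dot_norm : forall x : E, dot x x = `|x| ^+ 2.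
Variables (V : E -> E) (fhat : E -> \bar R).
Hypotheses (V_mono : monotone_op dot V) (fhat_proper : proper_efun fhat).
Let Z := zer (sum_op dot V fhat).
Variable opt : set E.
Hypothesis opt_zer : opt `<=` Z.
Variable eps : nat -> R.
Hypotheses (eps_gt0 : forall k, 0 < eps k) (eps_noninc : forall k, eps k.+1 <= eps k).

Lemma zer_fin z : Z z -> fhat z \is a fin_num.
Proof. by move=> [u [fz _] _]. Qed.

Lemma gap_fin z u : Z z -> fhat u \is a fin_num ->
  gap dot V fhat z u = (dot (u - z) (V u) + fine (fhat u) - fine (fhat z))%:E.
Proof. by move=> /zer_fin fz fu; rewrite /gap -{1}(fineK fz) -{1}(fineK fu). Qed.

Lemma gap_pinfty z u : Z z -> fhat u \isn't a fin_num -> gap dot V fhat z u = +oo%E.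
Proof.
move=> /zer_fin fz; have [fNy _] := fhat_proper.
rewrite fin_numE fNy /= negbK => /eqP fu.
by rewrite /gap fu -(fineK fz) addey // addye.
Qed.

(** By definition of the normal cone the supremum is attained at z. *)
Lemma support_fun_normal z p t : Z z -> normal_cone dot Z z p -> 0 <= t ->
  support_fun dot Z (t *: p) = (t * dot z p)%:E.
Proof.
move=> Zz Np t0; apply/eqP; rewrite eq_le; apply/andP; split.
  apply: ge_ereal_sup => _ [u Zu <-]; rewrite lee_fin (dotZr dot) ler_wpM2l //.
  by have := Np u Zu; rewrite (dotC dot u) (dotC dot z) (dotDr dot) (dotNr dot); lra.
by apply: ereal_sup_ubound; exists z => //; rewrite (dotZr dot).
Qed.

(** The terms of the series are nonnegative because u = z is admissible in the
    conjugate, so each is finite.  They are nonincreasing in k: by convexity of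
    t |-> F^*(t p) - t <z, p>, which vanishes at t = 0, in the direct form of a case
    analysis on the sign of <p, u - z>. *)
Lemma attouch_czarnecki_dual_gap z p :
    attouch_czarnecki dot V fhat Z opt eps -> opt z -> normal_cone dot Z z p ->
  exists b, dual_gap_bound dot V fhat eps z p b.
Proof.
move=> AC oz Np; have Zz := opt_zer oz.
have fz := zer_fin Zz.
pose F u := dot (u - z) (V u) + fine (fhat u) - fine (fhat z).
pose conj k := conjugate dot (gap dot V fhat z) (eps k *: p).
pose a k := (conj k - support_fun dot Z (eps k *: p))%E.
have suppE k : support_fun dot Z (eps k *: p) = (eps k * dot z p)%:E.
  by apply: support_fun_normal => //; exact: ltW.
have conj_ge k u : fhat u \is a fin_num -> ((eps k * dot u p - F u)%:E <= conj k)%E.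
  move=> fu; apply: ereal_sup_ubound; exists u => //.
  by rewrite (gap_fin Zz fu) (dotZr dot).
have Fz : F z = 0 by rewrite /F subrr -(scale0r (0 : E)) (dotZl dot); ring.
have a0 k : (0 <= a k)%E.
  by rewrite /a suppE sube_ge0 //; have := conj_ge k z fz; rewrite Fz subr0.
have asum : (\sum_(0 <= k <oo) a k < +oo)%E by exact: AC oz Np.
have afin k : a k \is a fin_num.
  rewrite ge0_fin_numE //; apply: le_lt_trans asum.
  apply: (@le_trans _ _ (\sum_(0 <= i < k.+1) a i)%E); last exact: nneseries_lim_ge.
  by rewrite big_nat_recr //= leeDr // sume_ge0.
pose b k := fine (a k).
have b0 k : 0 <= b k by exact: fine_ge0.
have conjE k : conj k = (b k + eps k * dot z p)%:E.
  have := afin k; rewrite /b /a suppE; case: (conj k) => [r||] // _.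
  by rewrite -EFinB /= subrK.
have bH k u : fhat u \is a fin_num -> eps k * dot p (u - z) <= F u + b k.
  move=> fu; have := conj_ge k u fu; rewrite conjE lee_fin.
  by rewrite (dotDr dot) (dotNr dot) (dotC dot p u) (dotC dot p z); lra.
exists b; split => //.
  move=> k; rewrite -lee_fin {1}/b (fineK (afin k.+1)) {1}/a.
  rewrite suppE leeBlDr // -EFinD.
  apply: ge_ereal_sup => _ [u _ <-].
  have [fu|fu] := boolP (fhat u \is a fin_num); last by rewrite (gap_pinfty Zz fu) addeNy leNye.
  rewrite (gap_fin Zz fu) (dotZr dot) -EFinB lee_fin -/(F u) -/(b k).
  have h1 := bH k u fu; have F0 := zero_gap_ge0 V_mono Zz fu; rewrite -/(F u) in F0.
  rewrite (dotC dot u) (dotC dot z); rewrite (dotDr dot) (dotNr dot) in h1.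
  have h2 := eps_noninc k; have h3 := eps_gt0 k; have h4 := eps_gt0 k.+1; have := b0 k.
  have [D0|D0] := leP 0 (dot p u - dot p z); nra.
have asumf : (\sum_(0 <= k <oo) a k)%E \is a fin_num.
  by rewrite ge0_fin_numE // nneseries_ge0.
apply: (@nnseries_bounded_cvgn _ _ (fine (\sum_(0 <= k <oo) a k)%E)) => // n.
rewrite -lee_fin (fineK asumf) seriesEnat /= -sumEFin.
under eq_bigr do rewrite /b fineK //.
exact: nneseries_lim_ge.
Qed.

Lemma edist_le_norm (x z : E) : (edist (x, z) <= `|x - z|%:E)%E.
Proof.
apply/lee_addgt0Pr => e e0; rewrite -EFinD; apply: edist_fin.
  by rewrite ltr_wpDl.
by rewrite -ball_normE /ball_ /= ltrDl.
Qed.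

Lemma edist_inf_le_norm (A : set E) (x z : E) : A z -> (edist_inf A x <= `|x - z|%:E)%E.
Proof.
move=> Az; apply: le_trans (edist_le_norm x z).
by apply: ereal_inf_lbound; exists z.
Qed.

Lemma edist_inf_fin (A : set E) (x z : E) : A z -> edist_inf A x \is a fin_num.
Proof.
move=> Az; rewrite ge0_fin_numE ?edist_inf_ge0 //.
by apply: le_lt_trans (edist_inf_le_norm x Az) _; rewrite ltry.
Qed.

(** Split u - z through a point q of Z that nearly realizes the distance: the part
    <p, q - z> is nonpositive. *)
Lemma dot_normal_le_dist (z p u : E) : Z z -> normal_cone dot Z z p ->
  dot p (u - z) <= `|p| * fine (edist_inf Z u).
Proof.
move=> Zz Np; have dfin := edist_inf_fin u Zz.
apply: (@le_of_segment _ _ _ `|p|) => t /andP[t0 _].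
have [_ [q Zq <-]] := lb_ereal_inf_adherent t0 dfin.
rewrite -[X in (_ < X + _)%E -> _]fineK // -EFinD => /edist_lt_ball.
rewrite -ball_normE /ball_ /= => uq.
have -> : u - z = (u - q) + (q - z) by rewrite addrA subrK.
rewrite (dotDr dot); have := Np q Zq.
have := cauchy_schwarz dot_norm p (u - q).
have := ler_wpM2l (normr_ge0 p) (ltW uq); lra.
Qed.

(** With t = tau^(1 / rho), Young's inequality for the product of t d and
    eps_k |p| / t produces exactly the term (tau / rho) d^rho of the sharpness
    condition. *)
Lemma sharpness_dual_gap (rho rho' : R) z p :
    1 < rho -> rho^-1 + rho'^-1 = 1 -> cvgn (series (fun k => eps k `^ rho')) ->
    sharpness dot V fhat Z opt rho -> opt z -> normal_cone dot Z z p ->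
  exists b, dual_gap_bound dot V fhat eps z p b.
Proof.
move=> rho1 rhoE eps_sum sharp oz Np; have Zz := opt_zer oz.
have [tau tau0 Hsharp] := sharp z oz.
have rho0 : 0 < rho by lra.
have rho'0 : 0 < rho'.
  by rewrite -invr_gt0; have : rho^-1 < 1 by [rewrite invf_lt1]; lra.
pose t := tau `^ rho^-1.
have t0 : 0 < t by rewrite powR_gt0.
have tE : t `^ rho = tau by rewrite -powRrM mulVf ?gt_eqF // powRr1 // ltW.
pose C := (`|p| / t) `^ rho' / rho'.
have C0 : 0 <= C by rewrite divr_ge0 ?powR_ge0 // ltW.
exists (fun k => C * eps k `^ rho'); split.
- by move=> k; rewrite mulr_ge0 // powR_ge0.
- move=> k; rewrite ler_wpM2l // ge0_ler_powR ?nnegrE ?(ltW rho'0) ?(ltW (eps_gt0 _)) //.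
- exact: (@is_cvg_seriesZ _ _ C).
move=> k u fu.
pose d := fine (edist_inf Z u).
have d0 : 0 <= d by rewrite fine_ge0 ?edist_inf_ge0.
have h1 : tau / rho * d `^ rho <= dot (u - z) (V u) + fine (fhat u) - fine (fhat z).
  have := Hsharp u; rewrite (gap_fin Zz fu) -(fineK (edist_inf_fin u Zz)).
  by rewrite poweR_EFin -EFinM lee_fin.
have h2 := ler_wpM2l (ltW (eps_gt0 k)) (dot_normal_le_dist u Zz Np).
apply: le_trans h2 _; rewrite -/d.
have -> : eps k * (`|p| * d) = (t * d) * (eps k * (`|p| / t)) by field; rewrite gt_eqF.
have e0 := ltW (eps_gt0 k).
apply: le_trans (conjugate_powR _ _ rho0 rho'0 rhoE) _.
- by rewrite mulr_ge0 // ltW.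
- by rewrite mulr_ge0 // divr_ge0 // ltW.
rewrite (@powRM _ t) ?(ltW t0) // tE (@powRM _ (eps k)) ?divr_ge0 ?(ltW t0) // /C; lra.
Qed.

End DualGap.

(** * Landau symbols and the regularization sequence *)

Section Asymptotics.
Context {R : realType}.

(** Index 0 is left out: the comparison sequences are only positive from 1 on. *)
Lemma eqo_of_ratio (u v : R^nat) : (forall k, 0 < v k.+1) ->
  (v k.+1)^-1 * u k.+1 @[k --> \oo] --> (0 : R) -> u =o_\oo v.
Proof.
move=> v0 uv; apply/eqoP => e e0.
have /cvgr0Pnorm_le /(_ e e0) [N _ HN] := uv.
exists N.+1 => // -[//|k] /= Nk; have := HN k Nk.
rewrite normrM normfV (gtr0_norm (v0 k)) ler_pdivrMl //= mulrC; exact.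
Qed.

Lemma eqO_of_near (u v : R^nat) (C : R) : 0 < C -> (forall k, 0 < v k.+1) ->
  (\forall k \near \oo, `|u k.+1| <= C * v k.+1) -> u =O_\oo v.
Proof.
move=> C0 v0 [N _ HN]; apply/eqO_exP; exists C => //.
exists N.+1 => // -[//|k] /= Nk; rewrite (gtr0_norm (v0 k)); exact: HN.
Qed.

Lemma sqrt_powR (n : nat) : Num.sqrt n.+1%:R = n.+1%:R `^ 2^-1 :> R.
Proof. by rewrite powR12_sqrt. Qed.

Lemma sqrt_div_powR (n : nat) (delta : R) :
  Num.sqrt n.+1%:R * (n.+1%:R `^ delta)^-1 = n.+1%:R `^ (2^-1 - delta).
Proof. by rewrite sqrt_powR powRD ?powRN // pnatr_eq0 implybT. Qed.

End Asymptotics.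

Section RegularizationSequence.
Context {R : realType}.
Variables (c a delta : R) (eps : nat -> R).
Hypotheses (c_gt0 : 0 < c) (a_gt0 : 0 < a) (delta_gt0 : 0 < delta).
Hypothesis eps_def : forall k, eps k = c / (k%:R + a) `^ delta.

Let ka_gt0 k : 0 < k%:R + a :> R.
Proof. by rewrite ltr_wpDl. Qed.

Lemma eps_gt0 k : 0 < eps k.
Proof. by rewrite eps_def divr_gt0 // powR_gt0. Qed.

Lemma eps_noninc k : eps k.+1 <= eps k.
Proof.
rewrite !eps_def ler_pM2l //; apply: powRN_noninc => //; last exact: ltW.
by rewrite lerD2r ler_nat.
Qed.

Lemma eps_convex k : eps k.+1 - eps k.+2 <= eps k - eps k.+1.
Proof.
have := powRN_midconvex (ka_gt0 k) (ltW delta_gt0).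
have -> : k%:R + a + 1 = k.+1%:R + a by rewrite -natr1; ring.
have -> : k%:R + a + 2 = k.+2%:R + a by rewrite -!natr1; ring.
move=> /(ler_wpM2l (ltW c_gt0)); rewrite !eps_def; lra.
Qed.

Lemma eps_cvg0 : eps @ \oo --> (0 : R).
Proof.
rewrite (_ : eps = fun k => c * ((k%:R + a) `^ delta)^-1); last exact/funext.
by rewrite -[X in _ --> X](mulr0 c); apply: cvgMr; exact: powRN_cvg0.
Qed.

(** The condition 1 < delta * q is delta > 1 / rho' when q = rho'. *)
Lemma eps_powR_summable q : 1 < delta * q -> cvgn (series (fun k => eps k `^ q)).
Proof.
move=> dq.
rewrite (_ : (fun k => _) = c `^ q *: (fun k : nat => ((k%:R + a) `^ (delta * q))^-1)).
  exact/is_cvg_seriesZ/powRN_summable.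
apply/funext => k; rewrite eps_def powRM ?(ltW c_gt0) ?invr_ge0 ?powR_ge0 //.
by rewrite -powRN -powRrM mulNr powRN.
Qed.

Lemma eps_le : exists2 C, 0 < C & forall k, eps k <= C * (k.+1%:R `^ delta)^-1.
Proof.
pose m := Num.min 1 a.
have m0 : 0 < m by rewrite lt_min ltr01.
exists (c / m `^ delta); first by rewrite divr_gt0 // powR_gt0.
move=> k; rewrite eps_def -mulrA ler_pM2l // -invfM -powRM //; last exact: ltW.
apply: powRN_noninc; rewrite ?(ltW delta_gt0) ?mulr_gt0 //.
have ma : m <= a by rewrite ge_min lexx orbT.
have m1 : m <= 1 by rewrite ge_min lexx.
rewrite -natr1 mulrDr mulr1 lerD //.
by rewrite -[leRHS]mul1r ler_wpM2r.
Qed.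

Lemma eps_ge : exists2 C, 0 < C & forall k, C * (k.+1%:R `^ delta)^-1 <= eps k.
Proof.
have a1 : 0 < 1 + a by rewrite addr_gt0.
exists (c / (1 + a) `^ delta); first by rewrite divr_gt0 // powR_gt0.
move=> k; rewrite eps_def -mulrA ler_pM2l // -invfM -powRM //; last exact: ltW.
apply: powRN_noninc; rewrite ?(ltW delta_gt0) //.
have k0 : (0 : R) <= k%:R by [].
by have := mulr_ge0 (ltW a_gt0) k0; rewrite -natr1; lra.
Qed.

Section Rates.
Variables (q r : R^nat) (B : R).
Hypotheses (q_ge0 : forall k, 0 <= q k) (B_ge0 : 0 <= B).
Hypothesis r_cvg : Num.sqrt k.+1%:R * r k @[k --> \oo] --> (0 : R).
Hypothesis q_le : forall k, q k.+1 <= r k + eps k * B.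

(** sqrt (k + 1) eps_k is of order (k + 1)^(1/2 - delta), which tends to 0. *)
Lemma residual_littleo : 2^-1 < delta -> q =o_\oo (fun k => (Num.sqrt k%:R)^-1).
Proof.
move=> d2; have [C C0 epsC] := eps_le.
apply: eqo_of_ratio => [k|]; first by rewrite invr_gt0 sqrtr_gt0 ltr0n.
pose u k := Num.sqrt k.+1%:R * r k + B * C * ((k%:R + 1) `^ (delta - 2^-1))^-1 : R.
have u0 : u @ \oo --> (0 : R).
  rewrite -[X in _ --> X](_ : 0 + B * C * 0 = 0); last by rewrite mulr0 addr0.
  by apply: cvgD r_cvg _; apply: cvgMr; apply: powRN_cvg0 => //; lra.
apply: (@squeeze_cvgr _ _ _ _ (fun=> 0) u) => //; last exact: cvg_cst.
near=> k; rewrite invrK mulr_ge0 ?sqrtr_ge0 //=.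
apply: le_trans (ler_wpM2l (sqrtr_ge0 _) (q_le k)) _.
rewrite /u mulrDr lerD2l.
have -> : k%:R + 1 = k.+1%:R :> R by rewrite -natr1.
rewrite -powRN opprB -sqrt_div_powR.
have := ler_wpM2l (mulr_ge0 (sqrtr_ge0 k.+1%:R) B_ge0) (epsC k); lra.
Unshelve. all: by end_near. Qed.

(** For delta <= 1 / 2 the regularization error dominates the o(1 / sqrt k) part. *)
Lemma residual_bigO : delta <= 2^-1 -> q =O_\oo (fun k => (k%:R `^ delta)^-1).
Proof.
move=> d2; have [C C0 epsC] := eps_le.
apply: (@eqO_of_near _ _ _ (1 + C * B)) => [|k|].
- by rewrite ltr_pwDl // mulr_ge0 // ltW.
- by rewrite invr_gt0 powR_gt0 // ltr0n.
have r1 : \forall k \near \oo, Num.sqrt k.+1%:R * r k <= 1.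
  by apply: (cvgr_le _ r_cvg).
apply: filterS r1 => k rk; rewrite ger0_norm //; apply: le_trans (q_le k) _.
rewrite mulrDl mul1r mulrAC; apply: lerD; last by rewrite ler_wpM2r.
have k0 : (0 : R) < k.+1%:R by rewrite ltr0n.
apply: (@le_trans _ _ (Num.sqrt k.+1%:R)^-1).
  by rewrite -[leRHS]mulr1 ler_pdivlMl ?sqrtr_gt0.
rewrite sqrt_powR lef_pV2 ?posrE ?powR_gt0 //; apply: ler_powR => //.
by rewrite ler1n.
Qed.

End Rates.

Lemma value_rate (D : R^nat) : (forall k, 0 <= D k) ->
  Num.sqrt k.+1%:R * (eps k * D k) @[k --> \oo] --> (0 : R) ->
  k.+1%:R `^ (2^-1 - delta) * D k @[k --> \oo] --> (0 : R).
Proof.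
move=> D0 Dcvg; have [C C0 epsC] := eps_ge.
apply: (@squeeze_cvgr _ _ _ _ (fun=> 0)
  (fun k => C^-1 * (Num.sqrt k.+1%:R * (eps k * D k)))).
- near=> k; rewrite mulr_ge0 ?powR_ge0 //= ler_pdivlMl // -sqrt_div_powR.
  have := ler_wpM2l (mulr_ge0 (sqrtr_ge0 k.+1%:R) (D0 k)) (epsC k); lra.
- exact: cvg_cst.
- by rewrite -[X in _ --> X](mulr0 C^-1); apply: cvgMr.
Unshelve. all: by end_near. Qed.

Lemma value_cvg0 (D : R^nat) : delta <= 2^-1 -> (forall k, 0 <= D k) ->
  k.+1%:R `^ (2^-1 - delta) * D k @[k --> \oo] --> (0 : R) ->
  D @ \oo --> (0 : R).
Proof.
move=> d2 D0 Dcvg.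
apply: (@squeeze_cvgr _ _ _ _ (fun=> 0) _ _ _ _ (cvg_cst _) Dcvg).
near=> k; rewrite D0 ler_peMl //= -[leLHS](powRr0 k.+1%:R).
by apply: ler_powR; [rewrite ler1n|lra].
Unshelve. all: by end_near. Qed.

End RegularizationSequence.

(** * The rates *)

Theorem theorem3p14
  (R : realType)
  (* real Hilbert space *)
  (E : completeNormedModType R) (dot : {dot E for @idfun R})
  (dot_norm : forall x : E, dot x x = `|x| ^+ 2)
  (* h smooth convex with gradient gradh *)
  (h : E -> R) (gradh : E -> E) (Lh : R)
  (h_convex : convex_function [set: convex_lmodType E] h)
  (h_grad : is_gradient dot h gradh)
  (gradh_cont : continuous gradh)
  (Lh_gt0 : 0 < Lh) (gradh_lip : Lh.-lipschitz gradh)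
  (* V monotone and Lipschitz *)
  (V : E -> E) (LV : R)
  (V_mono : monotone_op dot V)
  (LV_gt0 : 0 < LV) (V_lip : LV.-lipschitz V)
  (* fhat, hhat proper, convex, lsc *)
  (fhat hhat : E -> \bar R)
  (fhat_proper : proper_efun fhat) (fhat_convex : convex_efun fhat)
  (fhat_lsc : lower_semicontinuous fhat)
  (hhat_proper : proper_efun hhat) (hhat_convex : convex_efun hhat)
  (hhat_lsc : lower_semicontinuous hhat)
  (* the bilevel problem *)
  (H : E -> \bar R) (H_def : H = (fun x => (h x)%:E + hhat x)%E)
  (Z : set E) (Z_def : Z = zer (sum_op dot V fhat))
  (opt : set E) (opt_def : opt = argmin_on Z H)
  (* regularization parameters *)
  (c a delta : R) (c_gt0 : 0 < c) (a_gt0 : 0 < a) (delta_gt0 : 0 < delta)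
  (eps : nat -> R) (eps_def : forall k, eps k = c / (k%:R + a) `^ delta)
  (Phi : nat -> E -> E)
  (Phi_def : forall k x, Phi k x = V x + eps k *: gradh x)
  (g : nat -> E -> \bar R)
  (g_def : forall k x, g k x = (fhat x + (eps k)%:E * hhat x)%E)
  (* standing assumptions *)
  (subdiff_sum : forall k x, subdiff dot (g k) x =
    [set u + eps k *: v | u in subdiff dot fhat x & v in subdiff dot hhat x])
  (opt_cond : forall xs, opt xs ->
    exists2 u, subdiff dot H xs u & exists2 p, normal_cone dot Z xs p & u + p = 0)
  (hhat_bounded : forall B : set E, bounded_set B ->
    B `<=` [set x | subdiff dot hhat x !=set0] ->
    bounded_set (\bigcup_(x in B) subdiff dot hhat x))
  (* the algorithm *)
  (s : R) (s_gt0 : 0 < s) (s_lt : s < LV^-1)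
  (x y : nat -> E)
  (y_def : forall k,
    is_prox (fun u => s%:E * g k u)%E (x k - s *: Phi k (x k)) (y k))
  (x_def : forall k,
    is_prox (fun u => s%:E * g k u)%E (x k - s *: Phi k (y k)) (x k.+1))
  (xs : E) (xs_opt : opt xs)
  (* decomposition of the subgradients xi_k, k >= 1 *)
  (xi xif xih : nat -> E)
  (xi_def : forall k, xi k.+1 = s^-1 *: (x k - x k.+1) - Phi k (y k))
  (xif_subdiff : forall k, subdiff dot fhat (x k.+1) (xif k.+1))
  (xih_subdiff : forall k, subdiff dot hhat (x k.+1) (xih k.+1))
  (xi_split : forall k, xi k.+1 = xif k.+1 + eps k *: xih k.+1) :
  [/\ (* (i) *)
      attouch_czarnecki dot V fhat Z opt eps -> 2^-1 < delta ->
      (forall k, (0 < k)%N ->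
        edist_inf (sum_op dot V fhat (x k)) 0%R <= `|V (x k) + xif k|%:E)%E /\
      (fun k => `|V (x k) + xif k|) =o_\oo (fun k => (Num.sqrt k%:R)^-1),
      (* (ii) *)
      attouch_czarnecki dot V fhat Z opt eps -> delta = 2^-1 ->
      [/\ (forall k, (0 < k)%N ->
            edist_inf (sum_op dot V fhat (x k)) 0%R <= `|V (x k) + xif k|%:E)%E,
          (fun k => `|V (x k) + xif k|) =O_\oo (fun k => (Num.sqrt k%:R)^-1),
          elittleo (fun k => gap dot V fhat xs (x k))
                   (fun k => (Num.sqrt k%:R)^-1),
          H (x k) @[k --> \oo] --> H xs &
          exists2 xbar, opt xbar & weakly_cvg dot x xbar]
    & (* (iii) *)
      forall rho rho' : R, 1 < rho < 2 -> rho^-1 + rho'^-1 = 1 ->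
      sharpness dot V fhat Z opt rho -> rho'^-1 < delta < 2^-1 ->
      [/\ (forall k, (0 < k)%N ->
            edist_inf (sum_op dot V fhat (x k)) 0%R <= `|V (x k) + xif k|%:E)%E,
          (fun k => `|V (x k) + xif k|) =O_\oo (fun k => (k%:R `^ delta)^-1),
          elittleo (fun k => gap dot V fhat xs (x k))
                   (fun k => (Num.sqrt k%:R)^-1),
          elittleo (fun k => `|H (x k) - H xs|%E)
                   (fun k => (k%:R `^ (2^-1 - delta))^-1) &
          exists2 xbar, opt xbar & weakly_cvg dot x xbar]].

Proof.
subst H Z opt.
have y_prox k : is_prox (fun u => s%:E * (fhat u + (eps k)%:E * hhat u))%E
    (x k - s *: (V (x k) + eps k *: gradh (x k))) (y k).
  have := y_def k; rewrite Phi_def.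
  by rewrite (_ : g k = fun u => (fhat u + (eps k)%:E * hhat u)%E) //; apply/funext => u.
have x_step k : s^-1 *: (x k - x k.+1) - (V (y k) + eps k *: gradh (y k))
    = xif k.+1 + eps k *: xih k.+1.
  by rewrite -xi_split xi_def Phi_def.
have e_gt0 := eps_gt0 c_gt0 a_gt0 eps_def.
have e_noninc := eps_noninc c_gt0 a_gt0 delta_gt0 eps_def.
have rates := extragradient_rates dot_norm h_convex h_grad gradh_lip V_mono LV_gt0 V_lip
  fhat_proper fhat_convex fhat_lsc hhat_proper hhat_convex hhat_lsc opt_cond hhat_bounded
  e_gt0 e_noninc (eps_convex c_gt0 a_gt0 delta_gt0 eps_def)
  (eps_cvg0 a_gt0 delta_gt0 eps_def) _ s_gt0 s_lt y_prox
  xif_subdiff xih_subdiff x_step xs_opt.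
have Z_opt : argmin_on (zer (sum_op dot V fhat)) (fun x0 : E => ((h x0)%:E + hhat x0)%E)
    `<=` zer (sum_op dot V fhat) by move=> z [].
have dist_le k : (0 < k)%N ->
    (edist_inf (sum_op dot V fhat (x k)) 0%R <= `|V (x k) + xif k|%:E)%E.
  case: k => // k _; rewrite -[X in (_ <= X%:E)%E]normrN -[X in `|X|]add0r.
  by apply: edist_inf_le_norm; exists (xif k.+1).
have xs_zer := Z_opt _ xs_opt.
have hxs : hhat xs \is a fin_num := (opt_dom opt_cond xs_opt).2.
have fx k : fhat (x k.+1) \is a fin_num := (xif_subdiff k).1.
have hx k : hhat (x k.+1) \is a fin_num := (xih_subdiff k).1.
have gap_o : Num.sqrt k.+1%:R *
    (dot (x k.+1 - xs) (V (x k.+1)) + fine (fhat (x k.+1)) - fine (fhat xs))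
    @[k --> \oo] --> (0 : R) ->
    elittleo (fun k => gap dot V fhat xs (x k)) (fun k => (Num.sqrt k%:R)^-1).
  move=> gap0; split.
    by exists 1%N => // -[//|k] _ /=; rewrite (gap_fin xs_zer (fx k)).
  apply: eqo_of_ratio => [k|]; first by rewrite invr_gt0 sqrtr_gt0 ltr0n.
  apply: cvg_trans gap0; apply: near_eq_cvg; apply: nearW => k /=.
  by rewrite invrK (gap_fin xs_zer (fx k)).
pose D k := h (x k.+1) + fine (hhat (x k.+1)) - (h xs + fine (hhat xs)).
have HD k : ((h (x k.+1))%:E + hhat (x k.+1) - ((h xs)%:E + hhat xs))%E = (D k)%:E.
  by rewrite -(fineK (hx k)) -(fineK hxs).
(* the common part of the two cases delta <= 1 / 2 *)
have slow (dual_gap : forall z p, argmin_on (zer (sum_op dot V fhat))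
      (fun x0 : E => ((h x0)%:E + hhat x0)%E) z ->
      normal_cone dot (zer (sum_op dot V fhat)) z p ->
      exists b, dual_gap_bound dot V fhat eps z p b) : delta <= 2^-1 ->
    [/\ (fun k => `|V (x k) + xif k|) =O_\oo (fun k => (k%:R `^ delta)^-1),
        elittleo (fun k => gap dot V fhat xs (x k)) (fun k => (Num.sqrt k%:R)^-1),
        k.+1%:R `^ (2^-1 - delta) * `|D k| @[k --> \oo] --> (0 : R),
        D @ \oo --> (0 : R) &
        exists2 xbar, argmin_on (zer (sum_op dot V fhat))
           (fun x0 : E => ((h x0)%:E + hhat x0)%E) xbar & weakly_cvg dot x xbar].
  move=> d2; have [[r [B [B0 rcvg qle]]] gap0 H0 weak] := rates dual_gap.
  have rateD := value_rate c_gt0 a_gt0 delta_gt0 eps_def (fun k => normr_ge0 (D k)) H0.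
  have D0 : D @ \oo --> (0 : R).
    have nD0 := value_cvg0 d2 (fun k => normr_ge0 (D k)) rateD.
    exact: norm_cvg0 nD0.
  split=> //.
  - exact: (residual_bigO c_gt0 a_gt0 delta_gt0 eps_def _ B0 rcvg qle).
  - exact: gap_o.
  apply: weak; rewrite -[X in _ --> X]add0r.
  rewrite (_ : (fun k => _) = (fun k => D k + (h xs + fine (hhat xs)))).
    by apply: cvgD D0 _; exact: cvg_cst.
  by apply/funext => k; rewrite subrK.
split.
- move=> AC d2; split => //.
  have [[r [B [B0 rcvg qle]]] _ _ _] := rates (fun z p oz => attouch_czarnecki_dual_gap
    V_mono fhat_proper Z_opt e_gt0 e_noninc AC oz).
  exact: (residual_littleo c_gt0 a_gt0 delta_gt0 eps_def _ B0 rcvg qle).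
- move=> AC d2.
  have [|res gap0 _ D0 weak] := slow (fun z p oz => attouch_czarnecki_dual_gap
    V_mono fhat_proper Z_opt e_gt0 e_noninc AC oz); first by rewrite d2.
  split => //.
  + rewrite (_ : (fun k : nat => (Num.sqrt k%:R)^-1) = (fun k => (k%:R `^ delta)^-1)) //.
    by apply/funext => k; rewrite d2 powR12_sqrt.
  rewrite -cvg_shiftS -(fineK hxs) -EFinD.
  rewrite (_ : [sequence _]_n = EFin \o (fun k => D k + (h xs + fine (hhat xs)))).
    have Hr_cvg : D k + (h xs + fine (hhat xs)) @[k --> \oo] --> h xs + fine (hhat xs).
      have := cvgD D0 (cvg_cst (h xs + fine (hhat xs))); rewrite add0r; exact.
    by apply: cvg_EFin; [exact: nearW|exact: Hr_cvg].
  by apply/funext => k /=; rewrite subrK -(fineK (hx k)).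
- move=> rho rho' /andP[rho1 rho2] rhoE sharp /andP[d1 d2].
  have rho'0 : 0 < rho'.
    have rho0 : 0 < rho by lra.
    have rhoV : rho^-1 < 1 by rewrite invf_lt1.
    by rewrite -invr_gt0; lra.
  have eps_sum : cvgn (series (fun k => eps k `^ rho')).
    by apply: (eps_powR_summable c_gt0 a_gt0 eps_def); rewrite -ltr_pdivrMr // div1r.
  have [|res gap0 rateD _ weak] := slow (fun z p => sharpness_dual_gap dot_norm
    Z_opt e_gt0 e_noninc rho1 rhoE eps_sum sharp); first exact: ltW.
  split => //; split.
    by exists 1%N => // -[//|k] _ /=; rewrite HD.
  apply: eqo_of_ratio => [k|]; first by rewrite invr_gt0 powR_gt0 // ltr0n.
  apply: cvg_trans rateD; apply: near_eq_cvg; apply: nearW => k /=.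
  by rewrite invrK HD.
Qed.
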